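(* Let $X\subset\mathbb{A}^N$ be a closed subscheme whose ideal is generated by $m$ polynomials, $I_X=(f_1,\ldots,f_m)\subset k[x_1,\ldots,x_N]$. Let $n\in\mathbb{Z}_{\ge0}$, and let $g=n/2$ if $n$ is even and $g=(n+1)/2$ if $n$ is odd. Suppose that $m\le N$ and let $0\le e_1\le e_2\le\cdots\le e_m<g$ be an increasing sequence of integers. Put $e=e_1+\cdots+e_m$. (a) For $l\in\{e_m,e_m+1,\ldots,n\}$, the set $\pi^n_l(\mathcal{L}_n^{e_1,\ldots,e_m}(X))$ is locally closed (in $\mathcal{L}_l(\mathbb{A}^N)$). (b) For $\gamma\in\pi^n_{e_m}(\mathcal{L}_n^{e_1,\ldots,e_m}(X))$, there exists an open subset $U_{e_m}$ of $\pi^n_{e_m}(\mathcal{L}_n^{e_1,\ldots,e_m}(X))$ containing $\gamma$ such that, if for $i\in\{e_m+1,\ldots,n\}$ we denote by $U_i$ the inverse image of $U_{e_m}$ under the truncation map $\pi^n_i(\mathcal{L}_n^{e_1,\ldots,e_m}(X))\to\pi^n_{e_m}(\mathcal{L}_n^{e_1,\ldots,e_m}(X))$, then for every $l\in\{e_m,\ldots,n-1\}$ the truncation map $U_{l+1}\to U_l$ is a trivial fibration with fibre $\mathbb{A}^{N-a}$, where $a$ is the largest number of $\{0,\ldots,m\}$ satisfying $e_a<n-l$. (c) For $n>l\ge e_m$, the truncation map $$\mathcal{L}_n^{e_1,\ldots,e_m}(X)\to\pi^n_l(\mathcal{L}_n^{e_1,\ldots,e_m}(X))$$ is a locally trivial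 fibration with fibre an affine space. If $l\le n-e_m$, the dimension of this fibre is equal to $(N-m)(n-l)+e$. If $l=e_m$ and $m<N$, this dimension is at least $\lceil (N-m+1)(n/2)\rceil$.
   Context: $k$ is an algebraically closed field of arbitrary characteristic. For a closed subscheme $X\subset\mathbb{A}^N$ with ideal $I_X$, an $n$-jet on $X$ is a closed point of the jet scheme $\mathcal{L}_n(X)$, i.e. a tuple $\theta\in(k[t]/(t^{n+1}))^N$ with $f(\theta)=0$ for all $f\in I_X$. The set of $n$-jets is denoted $\mathcal{L}_n(X)$; it is a closed subset of $\mathcal{L}_n(\mathbb{A}^N)\cong\mathbb{A}^{N(n+1)}$ (Zariski topology). $\pi^n_l:\mathcal{L}_n(X)\to\mathcal{L}_l(X)$ ($n\ge l$) is the truncation map. Locally closed subsets carry their reduced structure; a map is a trivial fibration with fibre $F$ if it is isomorphic to the projection of a product of the target with $F$, and a locally trivial fibration with fibre $F$ if this holds Zariski-locally on the target. For $\theta\in\mathcal{L}_n(X)$, consider the quotient of the $k[[t]]$-module $(k[[t]]/(t^{n+1}))^N$ by the submodule generated by the rows of $\bigl(\frac{\partial f_i}{\partial x_j}(\theta)\bigr)_{1\le i\le m,\,1\le j\le N}$. It is isomorphic to $\bigoplus_{i=1}^N k[[t]]/(t^{e_i})$ for a unique sequence of integers $0\le e_1\le\cdots\le e_N\le n+1$; write $e_i=e_i(X;\theta)$ (independent of the generators chosen for $I_X$). For a sequence of integers $0\le e_1\le\cdots\le e_b<g$ with $b\le N$, $\mathcal{L}_n^{e_1,\ldots,e_b}(X)$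 is the set of $\theta\in\mathcal{L}_n(X)$ with $e_i(X;\theta)=e_i$ for $1\le i\le b$ and, if $b<N$, $e_{b+1}(X;\theta)\ge g$. Convention: $e_0=0$. *)

(* Defs.v *)
From mathcomp Require Export all_boot all_order all_algebra.
From mathcomp Require Export mpoly.

Set Implicit Arguments.
Unset Strict Implicit.
Unset Printing Implicit Defensive.

Import GRing.Theory.
Local Open Scope ring_scope.

(* ** Classical varieties over an algebraically closed field: (locally closed)
   subsets of 'rV[k]_d, viewed as the set of closed points of affine d-space
   and always carrying their reduced structure. *)

Definition zclosed (k : closedFieldType) (d : nat) (C : 'rV[k]_d -> Prop) : Prop :=
  exists I : {mpoly k[d]} -> Prop,
    forall x, C x <-> forall p, I p -> p.@[x 0] = 0.

Definition zopen (k : closedFieldType) (d : nat) (O : 'rV[k]_d -> Prop) : Prop :=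
  zclosed (fun x => ~ O x).

Definition zlocally_closed (k : closedFieldType) (d : nat)
    (A : 'rV[k]_d -> Prop) : Prop :=
  exists O C : 'rV[k]_d -> Prop,
    [/\ zopen O, zclosed C & forall x, A x <-> O x /\ C x].

Definition open_in (k : closedFieldType) (d : nat)
    (A U : 'rV[k]_d -> Prop) : Prop :=
  exists2 O : 'rV[k]_d -> Prop, zopen O & forall x, U x <-> A x /\ O x.

Definition regular_fun (k : closedFieldType) (d : nat)
    (A : 'rV[k]_d -> Prop) (h : 'rV[k]_d -> k) : Prop :=
  forall x, A x ->
    exists (O : 'rV[k]_d -> Prop) (p q : {mpoly k[d]}),
      [/\ zopen O, O x &
        forall y, A y -> O y -> q.@[y 0] != 0 /\ h y = p.@[y 0] / q.@[y 0]].

(* Maps are total functions; only their values on the source A matter. *)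
Definition morphism (k : closedFieldType) (d d' : nat)
    (A : 'rV[k]_d -> Prop) (B : 'rV[k]_d' -> Prop)
    (phi : 'rV[k]_d -> 'rV[k]_d') : Prop :=
  (forall x, A x -> B (phi x)) /\
  (forall j, regular_fun A (fun x => phi x 0 j)).

Definition isomorphism (k : closedFieldType) (d d' : nat)
    (A : 'rV[k]_d -> Prop) (B : 'rV[k]_d' -> Prop)
    (phi : 'rV[k]_d -> 'rV[k]_d') : Prop :=
  morphism A B phi /\
  exists psi : 'rV[k]_d' -> 'rV[k]_d,
    [/\ morphism B A psi,
        forall x, A x -> psi (phi x) = x &
        forall y, B y -> phi (psi y) = y].

Definition prod_variety (k : closedFieldType) (d r : nat)
    (B : 'rV[k]_d -> Prop) (F : 'rV[k]_r -> Prop) : 'rV[k]_(d + r) -> Prop :=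
  fun z => B (lsubmx z) /\ F (rsubmx z).

Definition affine_space (k : closedFieldType) (r : nat) : 'rV[k]_r -> Prop :=
  fun _ => True.

Definition trivial_fibration (k : closedFieldType) (d d' r : nat)
    (A : 'rV[k]_d -> Prop) (B : 'rV[k]_d' -> Prop)
    (h : 'rV[k]_d -> 'rV[k]_d') (F : 'rV[k]_r -> Prop) : Prop :=
  morphism A B h /\
  exists phi : 'rV[k]_d -> 'rV[k]_(d' + r),
    isomorphism A (prod_variety B F) phi /\
    forall x, A x -> lsubmx (phi x) = h x.

Definition locally_trivial_fibration (k : closedFieldType) (d d' r : nat)
    (A : 'rV[k]_d -> Prop) (B : 'rV[k]_d' -> Prop)
    (h : 'rV[k]_d -> 'rV[k]_d') (F : 'rV[k]_r -> Prop) : Prop :=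
  morphism A B h /\
  forall y, B y ->
    exists U : 'rV[k]_d' -> Prop,
      [/\ open_in B U, U y &
          trivial_fibration (fun x => A x /\ U (h x)) U h F].

(* ** Jets *)

(* The n-jets of affine N-space are the points of affine N(n+1)-space: the
   (i, j) coordinate of a jet (through vec_mx) is the coefficient of t^j in its
   i-th component. *)
Notation jet k N n := 'rV[k]_(N * n.+1).

(* The representative of degree <= n of the i-th component, an element of
   k[t]/(t^(n+1)). *)
Definition jet_poly (k : closedFieldType) (N n : nat) (theta : jet k N n)
    (i : 'I_N) : {poly k} :=
  \poly_(j < n.+1) vec_mx theta i (inord j).

Definition trunc (k : closedFieldType) (N n l : nat) (theta : jet k N n) :
    jet k N l :=
  mxvec (\matrix_(i < N, j < l.+1) (jet_poly theta i)`_j).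

Definition jet_eval (k : closedFieldType) (N n : nat) (theta : jet k N n)
    (p : {mpoly k[N]}) : {poly k} :=
  mmap polyC (jet_poly theta) p.

Definition ideal_gen (k : closedFieldType) (N m : nat)
    (f : 'I_m -> {mpoly k[N]}) : {mpoly k[N]} -> Prop :=
  fun p => exists c : 'I_m -> {mpoly k[N]}, p = \sum_(i < m) c i * f i.

Definition jets (k : closedFieldType) (N n : nat) (I : {mpoly k[N]} -> Prop) :
    jet k N n -> Prop :=
  fun theta => forall p, I p -> 'X^(n.+1) %| jet_eval theta p.

(* Existence of an isomorphism of R-modules M / S -> M' / S', where S and S' are
   submodules; h is the effect of the isomorphism on representatives. *)
Definition quotients_isomorphic (R : nzRingType) (M M' : lmodType R)
    (S : M -> Prop) (S' : M' -> Prop) : Prop :=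
  exists h : M -> M',
    [/\ forall x y, S (x - y) <-> S' (h x - h y),
        forall a x y, S' (h (a *: x + y) - (a *: h x + h y)) &
        forall z, exists x, S' (z - h x)].

Definition jacobian (k : closedFieldType) (N n m : nat)
    (f : 'I_m -> {mpoly k[N]}) (theta : jet k N n) : 'M[{poly k}]_(m, N) :=
  \matrix_(i < m, j < N) jet_eval theta (mderiv j (f i)).

(* The quotient of (k[t]/(t^(n+1)))^N by the rows of the Jacobian matrix is the
   quotient of k[t]^N by this submodule. *)
Definition jacobian_submodule (k : closedFieldType) (N n m : nat)
    (f : 'I_m -> {mpoly k[N]}) (theta : jet k N n) : 'rV[{poly k}]_N -> Prop :=
  fun v => exists (c : 'rV[{poly k}]_m) (w : 'rV[{poly k}]_N),
    v = c *m jacobian f theta + 'X^(n.+1) *: w.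

(* The direct sum of the k[t]/(t^(d_i)) is the quotient of k[t]^N by this
   submodule. *)
Definition power_submodule (k : closedFieldType) (N : nat)
    (d : N.-tuple nat) : 'rV[{poly k}]_N -> Prop :=
  fun v => forall i, 'X^(tnth d i) %| v 0 i.

(* d is the sequence e_1(X; theta) <= ... <= e_N(X; theta).  Both quotients are
   killed by t^(n+1), so that k[t]-linear and k[[t]]-linear isomorphisms between
   them are the same thing. *)
Definition jet_invariants (k : closedFieldType) (N n m : nat)
    (f : 'I_m -> {mpoly k[N]}) (theta : jet k N n) (d : N.-tuple nat) : Prop :=
  [/\ sorted leq d, all (fun x => x <= n.+1)%N d &
      quotients_isomorphic (jacobian_submodule f theta)
                           (@power_submodule k N d)].

(* The set of n-jets theta with e_i(X; theta) = e_i for 1 <= i <= b and, if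
   b < N, e_(b+1)(X; theta) >= g, where g = uphalf n is n/2 rounded up.
   Sequences are indexed from 0 here. *)
Definition stratum (k : closedFieldType) (N n m : nat)
    (f : 'I_m -> {mpoly k[N]}) (b : nat) (e : b.-tuple nat) :
    jet k N n -> Prop :=
  fun theta => jets (ideal_gen f) theta /\
    exists d : N.-tuple nat,
      [/\ jet_invariants f theta d,
          forall i, (i < b)%N -> nth 0%N d i = nth 0%N e i &
          (b < N)%N -> (uphalf n <= nth 0%N d b)%N].

Definition stratum_image (k : closedFieldType) (N n m : nat)
    (f : 'I_m -> {mpoly k[N]}) (b : nat) (e : b.-tuple nat) (l : nat) :
    jet k N l -> Prop :=
  fun x => exists2 theta : jet k N n, stratum f e theta & trunc l theta = x.
Arguments stratum_image {k N} n {m} f {b} e l _.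
Arguments stratum {k N} n {m} f {b} e _.

(* e_i with 1-based index i, and the convention e_0 = 0. *)
Definition expo (b : nat) (e : b.-tuple nat) (i : nat) : nat := nth 0%N (0%N :: e) i.

(* Main.v *)
From HB Require Import structures.
Require Import Defs.
From mathcomp Require Import perm qpoly polydiv zify ring.
From Stdlib Require Import Classical.

(** Write R = k[t]/(t^(n+1)), b = e_m, F(x) for the vector of the f_i(x) over R,
   J(x) for the Jacobian matrix over R, with rows indexed by the variables, and
   Im J for the R-module spanned by these rows.

   Two facts carry the proof.  First, if J has Smith exponents e_1 <= ... <= e_m
   then t^b R^m is contained in Im J, so a perturbation of J by a multiple of
   t^(b+1) has the form t W J; hence J + t W J = (1 + t W) J has the same image,
   1 + t W being invertible ([has_type_perturb]).  Thus the exponents and the image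
   of J(x) only depend on the truncation of x at level b.  Second, for an l-jet x
   with l >= b and a vector v, Taylor's formula gives
   F(x + t^(l+1) v) = F(x) + t^(l+1) v J(x) + t^(2l+2) (...),
   and the remainder lies in t^(l+2) Im J because 2l + 2 >= l + 2 + b
   ([eqs_step]).  Consequently an l-jet x is the truncation of an element of the
   stratum if and only if its Jacobian has exponents e and F(x) lies in
   t^(l+1) Im J: the coefficients of an error of that form can be cancelled one
   at a time ([stratum_imageP]).

   This criterion is turned into linear algebra over k.  Multiplication by a
   matrix A over R is a k-linear map, with matrix [mulT A], so that inclusions of
   R-submodules become inclusions of row spaces.  The ranks of the matrices of
   t^j J, for all j, determine the exponents ([has_type_smith]); a rank condition
   is an open condition together with a closed one, and so is the membership of
   F(x) in t^(l+1) Im J once the rank of the latter is prescribed.  This is (a).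

   For (b), the vectors v such that x + t^(l+1) v satisfies the criterion at level
   l + 1 are the solutions of the system F(x) + t^(l+1) v J in t^(l+2) Im J.  It is
   consistent, and its number of independent equations is the dimension of
   t^(l+1) Im J / t^(l+2) Im J, which is the number a of exponents smaller than
   n - l.  An affine system of constant rank with polynomial coefficients is
   trivial wherever one maximal minor stays invertible ([affine_bundle]).  The
   minors for all l are functions of the truncation at level b, and finitely many
   of them have to be invertible, which gives the neighbourhood of (b).

   For (c), the trivial fibrations of (b) are composed
   ([trivial_fibration_comp]), and the sum of the fibre dimensions telescopes
   ([sum_fibre_dimensions]). *)

Set Implicit Arguments.
Unset Strict Implicit.
Unset Printing Implicit Defensive.

Import GRing.Theory.
Local Open Scope ring_scope.

(** * Polynomial functions and the Zariski topology *)
Definition polyfun (k : closedFieldType) (d : nat) (h : 'rV[k]_d -> k) :=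
  exists p : {mpoly k[d]}, forall x, h x = p.@[x 0].

Section PolyFun.
Variables (k : closedFieldType) (d : nat).
Implicit Types h : 'rV[k]_d -> k.

Lemma polyfun_ext h h' : h =1 h' -> polyfun h -> polyfun h'.
Proof. by move=> hh' [p hp]; exists p => x; rewrite -hh'. Qed.

Lemma polyfun_cst c : polyfun (fun _ : 'rV[k]_d => c).
Proof. by exists c%:MP => x; rewrite mevalC. Qed.

Lemma polyfun_coord j : polyfun (fun x : 'rV[k]_d => x 0 j).
Proof. by exists 'X_j => x; rewrite mevalXU. Qed.

Lemma polyfunD h h' : polyfun h -> polyfun h' -> polyfun (fun x => h x + h' x).
Proof. by move=> [p hp] [q hq]; exists (p + q) => x; rewrite mevalD hp hq. Qed.

Lemma polyfunM h h' : polyfun h -> polyfun h' -> polyfun (fun x => h x * h' x).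
Proof. by move=> [p hp] [q hq]; exists (p * q) => x; rewrite mevalM hp hq. Qed.

Lemma polyfun_sum I (r : seq I) (P : pred I) (F : I -> 'rV[k]_d -> k) :
  (forall i, polyfun (F i)) -> polyfun (fun x => \sum_(i <- r | P i) F i x).
Proof.
move=> hF; elim: r => [|i r IH].
  by apply: polyfun_ext (polyfun_cst 0) => x; rewrite big_nil.
case Pi: (P i).
  by apply: polyfun_ext (polyfunD (hF i) IH) => x; rewrite big_cons Pi.
by apply: polyfun_ext IH => x; rewrite big_cons Pi.
Qed.

Lemma polyfun_prod I (r : seq I) (P : pred I) (F : I -> 'rV[k]_d -> k) :
  (forall i, polyfun (F i)) -> polyfun (fun x => \prod_(i <- r | P i) F i x).
Proof.
move=> hF; elim: r => [|i r IH].
  by apply: polyfun_ext (polyfun_cst 1) => x; rewrite big_nil.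
case Pi: (P i).
  by apply: polyfun_ext (polyfunM (hF i) IH) => x; rewrite big_cons Pi.
by apply: polyfun_ext IH => x; rewrite big_cons Pi.
Qed.

Lemma polyfunX h n : polyfun h -> polyfun (fun x => h x ^+ n).
Proof.
move=> hh; elim: n => [|n IH]; first exact: polyfun_cst.
by apply: polyfun_ext (polyfunM hh IH) => x; rewrite exprS.
Qed.

Lemma polyfun_comp d' (h : 'rV[k]_d' -> k) (phi : 'rV[k]_d -> 'rV[k]_d') :
  polyfun h -> (forall j, polyfun (fun x => phi x 0 j)) ->
  polyfun (fun x => h (phi x)).
Proof.
move=> [p hp] hphi.
apply: (@polyfun_ext (fun x => \sum_(i <- msupp p) p@_i * \prod_j phi x 0 j ^+ i j)).
  by move=> x; rewrite hp mevalE.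
apply: polyfun_sum => i; apply: polyfunM; first exact: polyfun_cst.
by apply: polyfun_prod => j; apply: polyfunX.
Qed.

Lemma polyfun_mulmx p q r (F : 'rV[k]_d -> 'M[k]_(p, q))
    (G : 'rV[k]_d -> 'M[k]_(q, r)) :
  (forall i j, polyfun (fun x => F x i j)) ->
  (forall i j, polyfun (fun x => G x i j)) ->
  forall i j, polyfun (fun x => (F x *m G x) i j).
Proof.
move=> hF hG i j.
apply: (@polyfun_ext (fun x => \sum_l F x i l * G x l j)).
  by move=> x; rewrite mxE.
by apply: polyfun_sum => l; apply: polyfunM.
Qed.

Lemma polyfun_det p (F : 'rV[k]_d -> 'M[k]_p) :
  (forall i j, polyfun (fun x => F x i j)) -> polyfun (fun x => \det (F x)).
Proof.
move=> hF; apply: polyfun_sum => s; apply: polyfunM; first exact: polyfun_cst.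
by apply: polyfun_prod => i.
Qed.

End PolyFun.

Section Zariski.
Variables (k : closedFieldType) (d : nat).
Implicit Types C O : 'rV[k]_d -> Prop.

Lemma zclosed_ext C C' : (forall x, C x <-> C' x) -> zclosed C -> zclosed C'.
Proof. by move=> CC' [I hI]; exists I => x; rewrite -CC'. Qed.

Lemma zclosed_eq0 (h : 'rV[k]_d -> k) : polyfun h -> zclosed (fun x => h x = 0).
Proof.
move=> [p hp]; exists (eq p) => x; rewrite hp.
by split=> [h0 q <-|/(_ p)] //; apply.
Qed.

(** The equations are all the polynomials that vanish on some member of the
   family, so that no set of equations has to be chosen for each member. *)
Lemma zclosed_forall T (C : T -> 'rV[k]_d -> Prop) :
  (forall i, zclosed (C i)) -> zclosed (fun x => forall i, C i x).
Proof.
move=> hC; exists (fun p => exists i, forall x, C i x -> p.@[x 0] = 0) => x.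
split=> [Cx p [i hi]|hx i]; first exact: hi.
case: (hC i) => I hI; apply/hI => p Ip; apply: hx; exists i => y Cy.
by move/hI: Cy; apply.
Qed.

Lemma zclosed_and C C' : zclosed C -> zclosed C' ->
  zclosed (fun x => C x /\ C' x).
Proof.
move=> hC hC'; apply: (@zclosed_ext (fun x => forall b : bool, (if b then C else C') x)).
  by move=> x; split=> [h|[h h'] []] //; split; [apply: (h true)|apply: (h false)].
by apply: zclosed_forall => -[].
Qed.

Lemma zclosed_or C C' : zclosed C -> zclosed C' ->
  zclosed (fun x => C x \/ C' x).
Proof.
move=> [I hI] [I' hI'].
exists (fun p => exists q q', [/\ I q, I' q' & p = q * q']) => x; split.
  move=> h p [q [q' [Iq Iq' ->]]]; rewrite mevalM.
  case: h => [/hI /(_ q Iq) ->|/hI' /(_ q' Iq') ->]; first exact: mul0r.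
  exact: mulr0.
move=> h; case: (classic (C x)) => [|nC]; [by left | right].
apply/hI' => q' Iq'; apply: NNPP => nq'; apply/nC/hI => q Iq.
have /eqP := h _ (ex_intro _ q (ex_intro _ q' (And3 Iq Iq' erefl))).
by rewrite mevalM mulf_eq0 => /orP[/eqP //|/eqP].
Qed.

Lemma zopen_ext O O' : (forall x, O x <-> O' x) -> zopen O -> zopen O'.
Proof. by move=> OO'; apply: zclosed_ext => x; rewrite OO'. Qed.

Lemma zopen_neq0 (h : 'rV[k]_d -> k) : polyfun h -> zopen (fun x => h x != 0).
Proof.
move=> hh; apply: (zclosed_ext _ (zclosed_eq0 hh)) => x.
by split=> [->|/negP/negPn/eqP]; rewrite ?eqxx.
Qed.

Lemma zopen_exists T (O : T -> 'rV[k]_d -> Prop) :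
  (forall i, zopen (O i)) -> zopen (fun x => exists i, O i x).
Proof.
move=> hO; apply: (zclosed_ext _ (zclosed_forall hO)) => x.
by split=> [h [i]|h i Oi]; [apply: h | apply: h; exists i].
Qed.

Lemma zopen_and O O' : zopen O -> zopen O' -> zopen (fun x => O x /\ O' x).
Proof.
move=> hO hO'; apply: (zclosed_ext _ (zclosed_or hO hO')) => x.
by split=> [[h []|h []]|/not_and_or].
Qed.

Lemma zopen_true : zopen (fun _ : 'rV[k]_d => True).
Proof.
by exists (fun p => p = 1) => x; split=> // /(_ 1 erefl) /eqP;
  rewrite meval1 oner_eq0.
Qed.

Lemma zopen_ltn p (O : nat -> 'rV[k]_d -> Prop) : (forall i, zopen (O i)) ->
  zopen (fun x => forall i, (i < p)%N -> O i x).
Proof.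
move=> hO; elim: p => [|p IH].
  by apply: zopen_ext zopen_true => x; split.
apply: zopen_ext (zopen_and IH (hO p)) => x; split.
  by move=> [h hp] i; rewrite ltnS leq_eqVlt => /predU1P[->|/h].
by move=> h; split=> [i /ltnW|]; apply: h.
Qed.

Lemma zopen_preim d' (O : 'rV[k]_d' -> Prop) (phi : 'rV[k]_d -> 'rV[k]_d') :
  (forall j, polyfun (fun x => phi x 0 j)) -> zopen O ->
  zopen (fun x => O (phi x)).
Proof.
move=> hphi [I hI]; apply: (@zclosed_ext (fun x => forall p, I p -> p.@[phi x 0] = 0)).
  by move=> x; rewrite hI.
apply: zclosed_forall => p; apply: zclosed_forall => _; apply: zclosed_eq0.
by apply: (@polyfun_comp _ _ _ (fun y => p.@[y 0])) => //; exists p.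
Qed.

(** Some equation of the complement does not vanish at x, and its nonvanishing
   locus is the required neighbourhood. *)
Lemma zopen_basic O x : zopen O -> O x ->
  exists q : {mpoly k[d]}, q.@[x 0] != 0 /\ forall y : 'rV[k]_d, q.@[y 0] != 0 -> O y.
Proof.
move=> [I hI] Ox; apply: NNPP => nex.
suff: ~ O x by apply.
apply/hI => p Ip; apply: NNPP => /eqP px; apply: nex; exists p; split=> // y py.
by apply: NNPP => /hI /(_ p Ip) py0; rewrite py0 eqxx in py.
Qed.

End Zariski.

(** Gaussian elimination provides constant matrices that extract an invertible
   block.  Letting them range over all constant matrices expresses a rank
   condition by determinants without any enumeration of minors. *)
Lemma rank_geP (F : fieldType) p q (A : 'M[F]_(p, q)) r :
  (r <= \rank A)%N <-> exists z : 'M[F]_(r, p) * 'M[F]_(q, r),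
    \det (z.1 *m A *m z.2) != 0.
Proof.
split=> [hr|[[L R]] /= h].
  exists (pid_mx r *m invmx (col_ebase A), invmx (row_ebase A) *m pid_mx r) => /=.
  rewrite -{2}[A]mulmx_ebase !mulmxA mulmxKV ?col_ebase_unit //.
  rewrite mulmxK ?row_ebase_unit // !mul_pid_mx.
  have rp := leq_trans hr (rank_leq_row A).
  have rq := leq_trans hr (rank_leq_col A).
  by rewrite (_ : minn _ _ = r) ?pid_mx_1 ?det1 ?oner_eq0 //; lia.
have : (L *m A *m R) \in unitmx by rewrite unitmxE unitfE.
move=> /mxrank_unit <-; rewrite (leq_trans (mxrankM_maxl _ _)) //.
exact: mxrankM_maxr.
Qed.

Lemma zopen_rank_ge (k : closedFieldType) d p q r (F : 'rV[k]_d -> 'M[k]_(p, q)) :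
  (forall i j, polyfun (fun x => F x i j)) ->
  zopen (fun x => (r <= \rank (F x))%N).
Proof.
move=> hF; apply: (zopen_ext (fun x => iff_sym (rank_geP (F x) r))).
apply: zopen_exists => -[L R]; apply: zopen_neq0.
have cst a b (M : 'M[k]_(a, b)) i j : polyfun (fun _ : 'rV[k]_d => M i j).
  exact: polyfun_cst.
apply: polyfun_det; apply: polyfun_mulmx => //; exact: polyfun_mulmx.
Qed.

Lemma zclosed_rank_le (k : closedFieldType) d p q r (F : 'rV[k]_d -> 'M[k]_(p, q)) :
  (forall i j, polyfun (fun x => F x i j)) ->
  zclosed (fun x => (\rank (F x) <= r)%N).
Proof.
move=> /(@zopen_rank_ge k d p q r.+1); apply: zclosed_ext => x.
by rewrite ltnNge; split=> [/negP/negPn|-> /negP].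
Qed.

(** * Regular functions and morphisms *)
Section Regular.
Variables (k : closedFieldType) (d : nat).
Implicit Types (A : 'rV[k]_d -> Prop) (h : 'rV[k]_d -> k).

(** The open neighbourhoods in the definition can be absorbed in the
   denominators: multiply numerator and denominator by the equation of a basic
   open set. *)
Lemma regular_funP A h : regular_fun A h <->
  forall x, A x -> exists p q : {mpoly k[d]}, q.@[x 0] != 0 /\
    forall y : 'rV[k]_d, A y -> q.@[y 0] != 0 -> h y = p.@[y 0] / q.@[y 0].
Proof.
split=> hh x Ax.
  have [O [p [q [oO Ox hO]]]] := hh x Ax.
  have [g [gx gO]] := zopen_basic oO Ox.
  exists (g * p), (g * q); split=> [|y Ay].
    by rewrite mevalM mulf_neq0 //; case: (hO x Ax Ox).
  rewrite !mevalM mulf_eq0 negb_or => /andP[gy qy].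
  by rewrite -mulf_div divff // mul1r; case: (hO y Ay (gO y gy)).
have [p [q [qx hq]]] := hh x Ax.
exists (fun y => q.@[y 0] != 0), p, q; split=> // [|y Ay Oy]; last by split=> //; apply: hq.
by apply: zopen_neq0; exists q.
Qed.

Lemma regular_ext A h h' : (forall x, A x -> h x = h' x) ->
  regular_fun A h -> regular_fun A h'.
Proof.
move=> hh' /regular_funP hh; apply/regular_funP => x Ax.
have [p [q [qx hq]]] := hh x Ax; exists p, q; split=> // y Ay qy.
by rewrite -hh' // hq.
Qed.

Lemma regular_sub A A' h : (forall x, A' x -> A x) ->
  regular_fun A h -> regular_fun A' h.
Proof.
move=> AA' /regular_funP hh; apply/regular_funP => x A'x.
have [p [q [qx hq]]] := hh x (AA' x A'x); exists p, q; split=> // y A'y qy.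
exact: hq (AA' y A'y) qy.
Qed.

Lemma regular_polyfun A h : polyfun h -> regular_fun A h.
Proof.
move=> [p hp]; apply/regular_funP => x Ax; exists p, 1.
by rewrite meval1 oner_eq0; split=> // y _ _; rewrite meval1 divr1.
Qed.

Lemma regular_cst A c : regular_fun A (fun=> c).
Proof. exact/regular_polyfun/polyfun_cst. Qed.

Lemma regularD A h h' : regular_fun A h -> regular_fun A h' ->
  regular_fun A (fun x => h x + h' x).
Proof.
move=> /regular_funP hh /regular_funP hh'; apply/regular_funP => x Ax.
have [p [q [qx hq]]] := hh x Ax; have [p' [q' [q'x hq']]] := hh' x Ax.
exists (p * q' + p' * q), (q * q'); split=> [|y Ay].
  by rewrite mevalM mulf_neq0.
rewrite mevalD !mevalM mulf_eq0 negb_or => /andP[qy q'y].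
by rewrite hq // hq' // addf_div.
Qed.

Lemma regularM A h h' : regular_fun A h -> regular_fun A h' ->
  regular_fun A (fun x => h x * h' x).
Proof.
move=> /regular_funP hh /regular_funP hh'; apply/regular_funP => x Ax.
have [p [q [qx hq]]] := hh x Ax; have [p' [q' [q'x hq']]] := hh' x Ax.
exists (p * p'), (q * q'); split=> [|y Ay].
  by rewrite mevalM mulf_neq0.
rewrite !mevalM mulf_eq0 negb_or => /andP[qy q'y].
by rewrite hq // hq' // mulf_div.
Qed.

Lemma regularV A h : (forall x, A x -> h x != 0) -> regular_fun A h ->
  regular_fun A (fun x => (h x)^-1).
Proof.
move=> h0 /regular_funP hh; apply/regular_funP => x Ax.
have [p [q [qx hq]]] := hh x Ax.
exists (q * q), (q * p); split=> [|y Ay].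
  rewrite mevalM mulf_neq0 //; apply: contra_neq (h0 x Ax) => px.
  by rewrite hq // px mul0r.
rewrite !mevalM mulf_eq0 negb_or => /andP[qy py].
by rewrite hq // invf_div -mulf_div divff // mul1r.
Qed.

Lemma regular_sum A I (r : seq I) (P : pred I) (F : I -> 'rV[k]_d -> k) :
  (forall i, regular_fun A (F i)) ->
  regular_fun A (fun x => \sum_(i <- r | P i) F i x).
Proof.
move=> hF; elim: r => [|i r IH].
  by apply: (regular_ext _ (regular_cst 0)) => x; rewrite big_nil.
case Pi: (P i).
  by apply: (regular_ext _ (regularD (hF i) IH)) => x; rewrite big_cons Pi.
by apply: (regular_ext _ IH) => x; rewrite big_cons Pi.
Qed.

Lemma regular_prod A I (r : seq I) (P : pred I) (F : I -> 'rV[k]_d -> k) :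
  (forall i, regular_fun A (F i)) ->
  regular_fun A (fun x => \prod_(i <- r | P i) F i x).
Proof.
move=> hF; elim: r => [|i r IH].
  by apply: (regular_ext _ (regular_cst 1)) => x; rewrite big_nil.
case Pi: (P i).
  by apply: (regular_ext _ (regularM (hF i) IH)) => x; rewrite big_cons Pi.
by apply: (regular_ext _ IH) => x; rewrite big_cons Pi.
Qed.

Lemma regularX A h n : regular_fun A h -> regular_fun A (fun x => h x ^+ n).
Proof.
move=> hh; elim: n => [|n IH]; first exact: regular_cst.
by apply: (regular_ext _ (regularM hh IH)) => x; rewrite exprS.
Qed.

Lemma regular_meval A d' (p : {mpoly k[d']}) (phi : 'rV[k]_d -> 'rV[k]_d') :
  (forall j, regular_fun A (fun x => phi x 0 j)) ->
  regular_fun A (fun x => p.@[phi x 0]).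
Proof.
move=> hphi; apply: (@regular_ext _
    (fun x => \sum_(i <- msupp p) p@_i * \prod_j phi x 0 j ^+ i j)).
  by move=> x; rewrite mevalE.
apply: regular_sum => i; apply: regularM; first exact: regular_cst.
by apply: regular_prod => j; apply: regularX.
Qed.

Definition regular_mx A p q (F : 'rV[k]_d -> 'M[k]_(p, q)) :=
  forall i j, regular_fun A (fun x => F x i j).

Lemma regular_mx_cst A p q (M : 'M[k]_(p, q)) : regular_mx A (fun=> M).
Proof. by move=> i j; apply: regular_cst. Qed.

Lemma regular_mx_mul A p q r (F : 'rV[k]_d -> 'M[k]_(p, q))
    (G : 'rV[k]_d -> 'M[k]_(q, r)) :
  regular_mx A F -> regular_mx A G -> regular_mx A (fun x => F x *m G x).
Proof.
move=> hF hG i j.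
apply: (@regular_ext _ (fun x => \sum_l F x i l * G x l j)).
  by move=> x; rewrite mxE.
by apply: regular_sum => l; apply: regularM.
Qed.

Lemma regular_mxD A p q (F G : 'rV[k]_d -> 'M[k]_(p, q)) :
  regular_mx A F -> regular_mx A G -> regular_mx A (fun x => F x + G x).
Proof.
move=> hF hG i j; apply: (regular_ext _ (regularD (hF i j) (hG i j))) => x.
by rewrite mxE.
Qed.

Lemma regular_mxN A p q (F : 'rV[k]_d -> 'M[k]_(p, q)) :
  regular_mx A F -> regular_mx A (fun x => - F x).
Proof.
move=> hF i j; apply: (regular_ext _ (regularM (regular_cst (-1)) (hF i j))) => x.
by rewrite mxE mulN1r.
Qed.

Lemma regular_row_mx A p q r (F : 'rV[k]_d -> 'M[k]_(p, q))
    (G : 'rV[k]_d -> 'M[k]_(p, r)) :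
  regular_mx A F -> regular_mx A G -> regular_mx A (fun x => row_mx (F x) (G x)).
Proof.
move=> hF hG i j; case: (split_ordP j) => l ->.
  by apply: (regular_ext _ (hF i l)) => x; rewrite row_mxEl.
by apply: (regular_ext _ (hG i l)) => x; rewrite row_mxEr.
Qed.

Lemma regular_det A p (F : 'rV[k]_d -> 'M[k]_p) :
  regular_mx A F -> regular_fun A (fun x => \det (F x)).
Proof.
move=> hF; apply: regular_sum => s; apply: regularM; first exact: regular_cst.
by apply: regular_prod => i.
Qed.

Lemma regular_invmx A p (F : 'rV[k]_d -> 'M[k]_p) :
  (forall x, A x -> F x \in unitmx) ->
  regular_mx A F -> regular_mx A (fun x => invmx (F x)).
Proof.
move=> uF hF i j; apply: (@regular_ext _
  (fun x => (\det (F x))^-1 * ((-1) ^+ (j + i) * \det (row' j (col' i (F x)))))).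
  by move=> x Ax; rewrite /invmx uF // !mxE.
apply: regularM; first apply: regularV.
- by move=> x /uF; rewrite unitmxE unitfE.
- exact: regular_det.
apply: regularM; first exact: regular_cst.
apply: regular_det => i' j'.
by apply: (regular_ext _ (hF (lift j i') (lift i j'))) => x; rewrite !mxE.
Qed.

End Regular.

Section Morphisms.
Variable k : closedFieldType.

Lemma morphism_polyfun d d' (A : 'rV[k]_d -> Prop) (B : 'rV[k]_d' -> Prop) phi :
  (forall x, A x -> B (phi x)) -> (forall j, polyfun (fun x => phi x 0 j)) ->
  morphism A B phi.
Proof. by move=> AB hp; split=> // j; apply: regular_polyfun. Qed.

Lemma morphism_mx d d' (A : 'rV[k]_d -> Prop) (B : 'rV[k]_d' -> Prop) phi :
  morphism A B phi -> regular_mx A phi.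
Proof. by move=> [_ h] i j; rewrite ord1. Qed.

(** Near x the numerator and the denominator of h become, after composition with
   phi, quotients of polynomials themselves. *)
Lemma regular_comp d d' (A : 'rV[k]_d -> Prop) (B : 'rV[k]_d' -> Prop) (h : 'rV[k]_d' -> k)
    (phi : 'rV[k]_d -> 'rV[k]_d') :
  regular_fun B h -> morphism A B phi -> regular_fun A (fun x => h (phi x)).
Proof.
move=> /regular_funP hh [AB hphi].
have rp p : _ := iffLR (@regular_funP _ _ _ _) (regular_meval p hphi).
apply/regular_funP => x Ax; have [p [q [qx hq]]] := hh _ (AB x Ax).
have [p1 [q1 [q1x h1]]] := rp p x Ax.
have [p2 [q2 [q2x h2]]] := rp q x Ax.
exists (p1 * q2 * q2), (q1 * q2 * p2); split=> [|y Ay].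
  rewrite !mevalM !mulf_neq0 //; apply: contra_neq qx => p2x.
  by rewrite h2 // p2x mul0r.
rewrite !mevalM !mulf_eq0 !negb_or => /andP[/andP[q1y q2y] p2y].
rewrite hq ?h1 ?h2 ?mulf_neq0 ?invr_eq0 //; last exact: AB.
by field; rewrite q1y q2y p2y.
Qed.

Lemma morphism_comp d1 d2 d3 (A : 'rV[k]_d1 -> Prop) (B : 'rV[k]_d2 -> Prop)
    (C : 'rV[k]_d3 -> Prop) phi psi :
  morphism A B phi -> morphism B C psi -> morphism A C (fun x => psi (phi x)).
Proof.
move=> hphi [BC hpsi]; split=> [x Ax|j]; first by apply: BC; case: hphi => h _; apply: h.
exact: regular_comp (hpsi j) hphi.
Qed.

Lemma regular_mx_comp d1 d2 (A : 'rV[k]_d1 -> Prop) (B : 'rV[k]_d2 -> Prop) p q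
    (F : 'rV[k]_d2 -> 'M[k]_(p, q)) phi :
  morphism A B phi -> regular_mx B F -> regular_mx A (fun x => F (phi x)).
Proof. by move=> hphi hF i j; apply: regular_comp (hF i j) hphi. Qed.

Lemma regular_lsubmx d r (A : 'rV[k]_(d + r) -> Prop) :
  regular_mx A (fun z => lsubmx z).
Proof.
move=> i j; rewrite ord1; apply: regular_polyfun.
by apply: (polyfun_ext _ (@polyfun_coord _ _ (lshift r j))) => x; rewrite mxE.
Qed.

Lemma regular_rsubmx d r (A : 'rV[k]_(d + r) -> Prop) :
  regular_mx A (fun z => rsubmx z).
Proof.
move=> i j; rewrite ord1; apply: regular_polyfun.
by apply: (polyfun_ext _ (@polyfun_coord _ _ (rshift d j))) => x; rewrite mxE.
Qed.

(** * Trivial fibrations *)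
Lemma trivial_fibration_ext d d' r (A A' : 'rV[k]_d -> Prop)
    (B B' : 'rV[k]_d' -> Prop) (h h' : 'rV[k]_d -> 'rV[k]_d') (F : 'rV[k]_r -> Prop) :
  (forall x, A x <-> A' x) -> (forall y, B y <-> B' y) ->
  (forall x, A x -> h x = h' x) ->
  trivial_fibration A B h F -> trivial_fibration A' B' h' F.
Proof.
move=> AA' BB' hh' [[AB hh] [phi [[[pAB hphi] [psi [[sBA hpsi] phiK psiK]]] phih]]].
have regA g : regular_fun A g -> regular_fun A' g.
  by apply: regular_sub => x /AA'.
split; first split=> [x /AA' Ax|j].
- by rewrite -hh' //; apply/BB'/AB.
- by apply: (regular_ext _ (regA _ (hh j))) => x /AA' Ax; rewrite hh'.
exists phi; split; last by move=> x /AA' Ax; rewrite -hh' // phih.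
split; first split=> [x /AA' Ax|j].
- by case: (pAB x Ax) => /BB' ? ?; split.
- exact: regA.
exists psi; split.
- split=> [z [/BB' Bz Fz]|j]; first by apply/AA'/sBA; split.
  by apply: (regular_sub _ (hpsi j)) => z [/BB' Bz Fz]; split.
- by move=> x /AA'; apply: phiK.
- by move=> z [/BB' Bz Fz]; apply: psiK; split.
Qed.

Lemma trivial_fibration_id d (A : 'rV[k]_d -> Prop) :
  trivial_fibration A A id (@affine_space k 0).
Proof.
have mid : morphism A A id by apply: morphism_polyfun => // j; apply: polyfun_coord.
split=> //; exists (fun x => row_mx x 0); split; last by move=> x _; rewrite row_mxKl.
split.
  split=> [x Ax|j]; first by split=> //; rewrite row_mxKl.
  apply: (regular_row_mx (F := id)); first by apply: morphism_mx mid.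
  exact: regular_mx_cst.
exists (fun z => lsubmx z); split.
- by split=> [z [] //|j]; apply: regular_lsubmx.
- by move=> x _; rewrite row_mxKl.
- move=> z _; rewrite -[RHS]hsubmxK; congr row_mx.
  by rewrite [RHS]thinmx0.
Qed.

(** The fibre coordinates of h2, read at h1 x, come first: the inverse rebuilds
   the point of B from them before it rebuilds the point of A. *)
Lemma trivial_fibration_comp d1 d2 d3 r1 r2 (A : 'rV[k]_d1 -> Prop)
    (B : 'rV[k]_d2 -> Prop) (C : 'rV[k]_d3 -> Prop) h1 h2 :
  trivial_fibration A B h1 (@affine_space k r1) ->
  trivial_fibration B C h2 (@affine_space k r2) ->
  trivial_fibration A C (fun x => h2 (h1 x)) (@affine_space k (r2 + r1)).
Proof.
move=> [mh1 [phi1 [[mphi1 [psi1 [mpsi1 phi1K psi1K]]] phi1h]]].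
move=> [mh2 [phi2 [[mphi2 [psi2 [mpsi2 phi2K psi2K]]] phi2h]]].
have mh := morphism_comp mh1 mh2.
split=> //.
exists (fun x => row_mx (h2 (h1 x)) (row_mx (rsubmx (phi2 (h1 x))) (rsubmx (phi1 x)))).
split; last by move=> x _; rewrite row_mxKl.
split.
  split=> [x Ax|j].
    by split=> //; rewrite row_mxKl; case: mh => h _; apply: h.
  apply: (regular_row_mx (F := fun x => h2 (h1 x))); first exact: morphism_mx mh.
  apply: (regular_row_mx (F := fun x => rsubmx (phi2 (h1 x)))
                         (G := fun x => rsubmx (phi1 x))).
    apply: (regular_mx_comp (F := fun z => rsubmx z) (morphism_comp mh1 mphi2)).
    exact: regular_rsubmx.
  apply: (regular_mx_comp (F := fun z => rsubmx z) mphi1); exact: regular_rsubmx.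
pose base (z : 'rV[k]_(d3 + (r2 + r1))) :=
  psi2 (row_mx (lsubmx z) (lsubmx (rsubmx z))).
have mbase : morphism (prod_variety C (@affine_space k (r2 + r1))) B base.
  apply: morphism_comp mpsi2; split=> [z [Cz _]|j].
    by split=> //; rewrite row_mxKl.
  apply: (regular_row_mx (F := fun z => lsubmx z)); first exact: regular_lsubmx.
  apply: (regular_mx_comp (F := fun z => lsubmx z)
     (B := fun=> True) (phi := fun z => rsubmx z)); last exact: regular_lsubmx.
  by split=> // j'; apply: regular_rsubmx.
exists (fun z => psi1 (row_mx (base z) (rsubmx (rsubmx z)))); split.
- apply: morphism_comp mpsi1; split=> [z Cz|j].
    by split=> //; rewrite row_mxKl; case: mbase => h _; apply: h.
  apply: (regular_row_mx (F := base)); first exact: morphism_mx mbase.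
  apply: (regular_mx_comp (F := fun z => rsubmx z)
     (B := fun=> True) (phi := fun z => rsubmx z)); last exact: regular_rsubmx.
  by split=> // j'; apply: regular_rsubmx.
- move=> x Ax; have Bx : B (h1 x) by case: mh1 => h _; apply: h.
  rewrite /base row_mxKl row_mxKr row_mxKl row_mxKr.
  by rewrite -(phi2h _ Bx) hsubmxK phi2K // -(phi1h _ Ax) hsubmxK phi1K.
- move=> z Cz; have Bz : B (base z) by case: mbase => h _; apply: h.
  set w := psi1 _.
  have phiw : phi1 w = row_mx (base z) (rsubmx (rsubmx z)).
    by apply: psi1K; split=> //; rewrite row_mxKl.
  have Aw : A w by case: mpsi1 => h _; apply: h; split=> //; rewrite row_mxKl.
  have h1w : h1 w = base z by rewrite -phi1h // phiw row_mxKl.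
  have phib : phi2 (base z) = row_mx (lsubmx z) (lsubmx (rsubmx z)).
    by apply: psi2K; case: Cz => ? ?; split=> //; rewrite row_mxKl.
  by rewrite h1w -phi2h // phiw phib row_mxKl !row_mxKr !hsubmxK.
Qed.

End Morphisms.

(** * Affine systems of constant rank *)
Section LinearAlgebra.
Variable F : fieldType.

(** If H is a right inverse of E then 1 - H E is a projector that kills E on the
   left; K and K' are its factors through its rank.  Thus v K gives coordinates of
   v modulo the row space of E, and K' is a section of them. *)
Lemma row_free_split a N (E : 'M[F]_(a, N)) : row_free E ->
  exists r (K : 'M[F]_(N, r)) (K' : 'M[F]_(r, N)) (H : 'M[F]_(N, a)),
    [/\ (a + r)%N = N, E *m K = 0, K' *m K = 1%:M & K *m K' + H *m E = 1%:M].
Proof.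
move=> fE; have /row_freeP [H EH] := fE.
pose p : 'M[F]_N := 1%:M - H *m E.
have Ep : E *m p = 0 by rewrite mulmxBr mulmx1 mulmxA EH mul1mx subrr.
have pp : p *m p = p by rewrite {1}/p mulmxBl mul1mx -mulmxA Ep mulmx0 subr0.
have KK := mulmx_base p.
have K'K : row_base p *m col_base p = 1%:M.
  apply: (row_free_inj (row_base_free p)); rewrite mul1mx -mulmxA.
  apply: (row_full_inj (col_base_full p)).
  by rewrite mulmxA KK pp.
exists (\rank p), (col_base p), (row_base p), H; split=> //.
- apply/eqP; rewrite eqn_leq; apply/andP; split.
    have: (E <= kermx p)%MS by apply/sub_kermxP.
    move=> /mxrankS; rewrite (eqnP fE) mxrank_ker.
    by have := rank_leq_row p; lia.
  have eN : \rank (p + H *m E)%R = N by rewrite /p subrK mxrank1.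
  rewrite -{1}eN.
  apply: leq_trans (mxrank_add _ _) _; rewrite addnC leq_add2r.
  exact: leq_trans (mxrankM_maxr _ _) (rank_leq_row _).
- by apply: (row_free_inj (row_base_free p)); rewrite mul0mx -mulmxA KK.
- by rewrite KK /p subrK.
Qed.

(** The rows that complete T are chosen in the row space of A, as a basis of a
   complement of its intersection with that of T, and are thus of the form
   E A. *)
Lemma rank_complement_rows q N M r a (T : 'M[F]_(q, M)) (A : 'M[F]_(N, M)) :
  \rank T = r -> \rank (col_mx T A) = (r + a)%N ->
  exists (S : 'M_(r, q)) (E : 'M_(a, N)) (C : 'M_(M, r + a)),
    col_mx (S *m T) (E *m A) *m C = 1%:M.
Proof.
move=> rT rTA.
have eTA : (T + (A :\: T) :=: T + A)%MS.
  apply/eqmxP; rewrite !addsmx_sub !addsmxSl /=.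
  rewrite (submx_trans (diffmxSl _ _) (addsmxSr _ _)) /=.
  rewrite -(addsmx_diff_cap_eq A T) addsmx_sub addsmxSr /=.
  exact: submx_trans (capmxSr _ _) (addsmxSl _ _).
have ra : \rank (A :\: T)%MS = a.
  move: rTA; rewrite -addsmxE -eTA addsmxC mxrank_disjoint_sum ?capmx_diff //.
  by rewrite rT addnC => /addnI.
have /submxP[S hS] : (row_base T <= T)%MS by rewrite eq_row_base.
have /submxP[E hE] : (row_base (A :\: T)%MS <= A)%MS.
  by rewrite eq_row_base diffmxSl.
subst r a; exists S, E; apply/row_freeP.
rewrite -hS -hE /row_free -addsmxE.
by rewrite (adds_eqmx (eq_row_base _) (eq_row_base _)) eTA addsmxE rTA.
Qed.

Section Equations.
Variables (q N M r a : nat) (T : 'M[F]_(q, M)) (A : 'M[F]_(N, M)).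
Variables (S : 'M[F]_(r, q)) (E : 'M[F]_(a, N)) (C : 'M[F]_(M, r + a)).

Definition frame := col_mx (S *m T) (E *m A) *m C.

(** Right multiplication by C and by the inverse of the frame turns the rows of
   S T and E A into the unit vectors; the residue keeps the coordinates along
   E A.  On the common row space they measure the failure to lie in T. *)
Definition residue p (w : 'M[F]_(p, M)) : 'M[F]_(p, a) :=
  w *m C *m invmx frame *m col_mx 0 1%:M.

Hypothesis uG : frame \in unitmx.

Lemma residue_E : E *m residue A = 1%:M.
Proof.
have -> : E *m residue A = row_mx 0 1%:M *m
    (col_mx (S *m T) (E *m A) *m C *m invmx frame *m col_mx 0 1%:M).
  by rewrite /residue !mulmxA mul_row_col mul0mx mul1mx add0r.
by rewrite mulmxV // mul1mx mul_row_col mul0mx mul1mx add0r.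
Qed.

Lemma residueP p (w : 'M[F]_(p, M)) :
  \rank T = r -> \rank (col_mx T A) = (r + a)%N -> (w <= col_mx T A)%MS ->
  (w <= T)%MS = (residue w == 0).
Proof.
move=> rT rTA wTA.
have fH : row_free (col_mx (S *m T) (E *m A)).
  by apply/row_freeP; exists (C *m invmx frame); rewrite mulmxA mulmxV.
have fS : \rank (S *m T) = r.
  have : row_free (S *m T); last by move/eqnP.
  apply/row_freeP; exists (C *m invmx frame *m col_mx 1%:M 0).
  have -> : S *m T = row_mx 1%:M 0 *m col_mx (S *m T) (E *m A).
    by rewrite mul_row_col mul0mx mul1mx addr0.
  rewrite -mulmxA [X in _ *m X]mulmxA [X in _ *m (X *m _)]mulmxA mulmxV // mul1mx.
  by rewrite mul_row_col mul0mx mul1mx addr0.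
have eST : (S *m T :=: T)%MS.
  by apply/eqmxP; rewrite -(geq_leqif (mxrank_leqif_eq (submxMl S T))) rT fS.
have eH : (col_mx (S *m T) (E *m A) :=: col_mx T A)%MS.
  have sH : (col_mx (S *m T) (E *m A) <= col_mx T A)%MS.
    rewrite -!addsmxE addsmx_sub (submx_trans (submxMl _ _) (addsmxSl _ _)).
    exact: submx_trans (submxMl _ _) (addsmxSr _ _).
  by apply/eqmxP; rewrite -(geq_leqif (mxrank_leqif_eq sH)) rTA (eqnP fH).
have res z : residue (z *m col_mx (S *m T) (E *m A)) = z *m col_mx 0 1%:M.
  by rewrite /residue -!(mulmxA z) mulmxV // mul1mx.
move: wTA; rewrite -eH => /submxP[z ->]; rewrite res -[z]hsubmxK.
rewrite !mul_row_col mulmx0 add0r mulmx1 -eST.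
apply/idP/eqP => [|->]; last by rewrite mul0mx addr0 submxMl.
move=> /submxP[y].
have -> : y *m (S *m T) = row_mx y 0 *m col_mx (S *m T) (E *m A).
  by rewrite mul_row_col mul0mx addr0.
rewrite -mul_row_col.
by move/(row_free_inj fH)/eq_row_mx => [].
Qed.

End Equations.
End LinearAlgebra.

(** Since E A = 1, adding a combination of rows of E to top x changes the value
   of the equations by exactly the coefficients of the combination.  Therefore
   the coordinates of top x modulo the row space of E are free, and they
   determine top x: subtract from any lift its defect times E. *)
Lemma affine_bundle (k : closedFieldType) d d' N a
    (X : 'rV[k]_d -> Prop) (B : 'rV[k]_d' -> Prop)
    (h : 'rV[k]_d -> 'rV[k]_d') (top : 'rV[k]_d -> 'rV[k]_N)
    (ext : 'rV[k]_(d' + N) -> 'rV[k]_d)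
    (c : 'rV[k]_d' -> 'rV[k]_a) (A : 'rV[k]_d' -> 'M[k]_(N, a)) (E : 'M[k]_(a, N)) :
  (forall j, polyfun (fun x => h x 0 j)) ->
  (forall j, polyfun (fun x => top x 0 j)) ->
  (forall j, polyfun (fun z => ext z 0 j)) ->
  (forall z, row_mx (h (ext z)) (top (ext z)) = z) ->
  (forall x, ext (row_mx (h x) (top x)) = x) ->
  row_free E -> regular_mx B c -> regular_mx B A ->
  (forall y, B y -> E *m A y = 1%:M) ->
  (forall x, X x <-> B (h x) /\ c (h x) + top x *m A (h x) = 0) ->
  trivial_fibration X B h (@affine_space k (N - a)).
Proof.
move=> ph ptop pext trunc_top_ext hextK fE rc rA EA XP.
have [r [K [K' [H [ar EK K'K KK']]]]] := row_free_split fE.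
have er : r = (N - a)%N by lia.
subst r.
have mh : morphism X B h by apply: morphism_polyfun => // x /XP[].
have rtop : regular_mx X top by move=> i j; rewrite ord1; apply: regular_polyfun.
split=> //; exists (fun x => row_mx (h x) (top x *m K)).
split; last by move=> x _; rewrite row_mxKl.
pose P := prod_variety B (@affine_space k (N - a)).
(* The lift of the fibre coordinates, corrected to satisfy the equations. *)
pose v (z : 'rV[k]_(d' + (N - a))) := rsubmx z *m K' -
  (c (lsubmx z) + rsubmx z *m K' *m A (lsubmx z)) *m E.
have ml : morphism P B (fun z => lsubmx z).
  by split=> [z []|j] //; apply: regular_lsubmx.
have rv : regular_mx P v.
  have ru : regular_mx P (fun z => rsubmx z *m K').
    by apply: regular_mx_mul; [apply: regular_rsubmx | apply: regular_mx_cst].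
  apply: regular_mxD => //; apply: regular_mxN.
  apply: regular_mx_mul; last exact: regular_mx_cst.
  apply: regular_mxD; first exact: (regular_mx_comp ml rc).
  by apply: regular_mx_mul => //; apply: (regular_mx_comp ml rA).
have vK z : v z *m K = rsubmx z.
  by rewrite /v mulmxBl -!mulmxA K'K EK !mulmx0 subr0 mulmx1.
have vA z : P z -> c (lsubmx z) + v z *m A (lsubmx z) = 0.
  move=> [Bz _]; rewrite /v mulmxBl -(mulmxA _ E) EA // mulmx1.
  by rewrite addrA subrr.
have mext : morphism P X (fun z => ext (row_mx (lsubmx z) (v z))).
  split=> [z Pz|j].
    have := trunc_top_ext (row_mx (lsubmx z) (v z)) => /eq_row_mx[e1 e2].
    by apply/XP; rewrite e1 e2; split; [case: Pz | apply: vA].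
  apply: (@regular_comp _ _ _ P (fun=> True) (fun w => ext w 0 j)
            (fun z => row_mx (lsubmx z) (v z))).
    exact: regular_polyfun.
  split=> // j'; apply: (regular_row_mx (F := fun z => lsubmx z) (G := v)) => //.
  exact: regular_lsubmx.
split.
  split=> [x Xx|j]; first by split=> //; rewrite row_mxKl; case/XP: Xx.
  apply: (regular_row_mx (F := h) (G := fun x => top x *m K)).
    exact: morphism_mx mh.
  by apply: regular_mx_mul => //; apply: regular_mx_cst.
exists (fun z => ext (row_mx (lsubmx z) (v z))); split=> //.
- move=> x Xx; rewrite -[RHS]hextK row_mxKl; congr (ext (row_mx _ _)).
  rewrite /v row_mxKl row_mxKr; case/XP: Xx => Bx /eqP.
  rewrite addrC addr_eq0 => /eqP cx; rewrite -[RHS]mulmx1 -KK' mulmxDr mulmxA.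
  congr (_ + _).
  have -> : top x *m K *m K' = top x - top x *m H *m E.
    by rewrite -[X in X - _]mulmx1 -KK' mulmxDr !mulmxA addrK.
  rewrite mulmxBl -(mulmxA _ E) EA // mulmx1 cx.
  by rewrite addrA subrr add0r mulNmx opprK mulmxA.
- move=> z Pz; have := trunc_top_ext (row_mx (lsubmx z) (v z)) => /eq_row_mx[e1 e2].
  by rewrite e1 e2 vK hsubmxK.
Qed.

(** * Smith normal form over k[t]/(t^(n+1)) *)
Notation trunc_ring k n := {poly %/ ('X^(n.+1) : {poly k})}.

Section TruncRing.
Variables (k : closedFieldType) (n : nat).
Local Notation R := (trunc_ring k n).
Local Notation pi := (in_qpoly ('X^(n.+1) : {poly k})).
Implicit Types (p : {poly k}) (x y : R).

Lemma coef_pi p s : (pi p)`_s = if (s < n.+1)%N then p`_s else 0.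
Proof.
rewrite /= mk_monic_Xn -coef_take_poly; congr (_ _ s).
rewrite -{1}(poly_take_drop n.+1 p) addrC Pdiv.RingMonic.rmodp_addl_mul_small ?monicXn //.
by rewrite size_polyXn ltnS size_take_poly.
Qed.

Lemma coef_ge x s : (n < s)%N -> x`_s = 0.
Proof.
by move=> ns; rewrite nth_default // (leq_trans (size_npoly x)) // mk_monic_Xn size_polyXn.
Qed.

Lemma truncP x y : (forall s, (s <= n)%N -> x`_s = y`_s) -> x = y.
Proof.
move=> xy; apply/val_inj/polyP => s /=.
by case: (leqP s n) => [/xy|ns] //; rewrite !coef_ge.
Qed.

Lemma pi_val x : pi x = x.
Proof. by apply: truncP => s sn; rewrite coef_pi ltnS sn. Qed.

Lemma pi_eqP p q : reflect (pi p = pi q) ('X^(n.+1) %| p - q).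
Proof.
apply: (iffP idP) => [/dvdpP[r pq]|pq].
  apply: truncP => s sn; rewrite !coef_pi ltnS sn.
  by rewrite -[p](subrK q) pq coefD coefMXn ltnS sn add0r.
rewrite -[p - q](poly_take_drop n.+1) dvdp_addl ?dvdp_mull //.
rewrite (_ : take_poly _ _ = 0) ?dvdp0 //; apply/polyP => s.
rewrite coef_take_poly coef0; case: ltnP => // sn.
have /(congr1 (fun x : R => x`_s)) := pq.
by rewrite !coef_pi sn coefB => ->; rewrite subrr.
Qed.

Lemma pi_eq0 p : (pi p = 0) <-> ('X^(n.+1) %| p).
Proof. by rewrite -[p in X in _ <-> X]subr0 -(rmorph0 pi); split=> /pi_eqP. Qed.

Definition tR : R := pi 'X.

Lemma tRX i : tR ^+ i = pi 'X^i.
Proof. by rewrite rmorphXn. Qed.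

Lemma tRX_eq0 i : (n < i)%N -> tR ^+ i = 0.
Proof. by move=> ni; rewrite tRX; apply/pi_eq0; rewrite dvdp_exp2l. Qed.

Lemma coef_tRM i x s : (s <= n)%N ->
  (tR ^+ i * x)`_s = if (s < i)%N then 0 else x`_(s - i).
Proof.
by move=> sn; rewrite -[x]pi_val tRX -rmorphM coef_pi ltnS sn coefXnM pi_val.
Qed.

Lemma tR_shift i x : (forall s, (s < i)%N -> x`_s = 0) ->
  x = tR ^+ i * pi (drop_poly i x).
Proof.
move=> x0; apply: truncP => s sn; rewrite coef_tRM // coef_pi.
case: ltnP => [/x0 //|si]; rewrite ltnS (leq_trans (leq_subr _ _) sn).
by rewrite coef_drop_poly subnK.
Qed.

(** A polynomial with nonzero constant term is coprime to t^(n+1). *)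
Lemma tR_unit x : x`_0 != 0 -> x \is a GRing.unit.
Proof.
move=> x0; have cx : coprimep (mk_monic ('X^(n.+1) : {poly k})) x.
  move: (polyn x) x0 => {x} y y0; rewrite mk_monic_Xn coprimep_expl // coprimep_sym coprimepX.
  by rewrite /root horner_coef0.
by apply/unitrPr; exists (qpoly_inv x); apply: qpoly_mulzV.
Qed.

(** The t-adic order, with value n + 1 at 0. *)
Definition tord x := find (fun s => x`_s != 0) (iota 0 n.+1).

Lemma tord_le x : (tord x <= n.+1)%N.
Proof. by rewrite -[X in (_ <= X)%N](size_iota 0) find_size. Qed.

Lemma tord_coef x s : (s < tord x)%N -> x`_s = 0.
Proof.
move=> sx; have := before_find 0%N sx; rewrite nth_iota; last exact: leq_trans (tord_le x).
by move/negbFE/eqP.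
Qed.

Lemma tord_nz x : (tord x <= n)%N -> x`_(tord x) != 0.
Proof.
move=> ox; have := @nth_find _ 0%N (fun s => x`_s != 0) (iota 0 n.+1).
by rewrite has_find size_iota ltnS nth_iota ?ltnS //; apply.
Qed.

(** Exponents beyond the end of c are n + 1, so that the corresponding entries
   vanish and the empty list describes the zero matrix. *)
Definition diag_t (p q : nat) (c : seq nat) : 'M[R]_(p, q) :=
  \matrix_(i, j) (tR ^+ nth n.+1 c i *+ (i == j :> nat)).

(** An entry of least order o divides all the others.  It is moved to the corner
   and its row and column are cleared; the induction is applied to the Schur
   complement of the matrix divided by t^o, so the next exponents are at least
   o. *)
Lemma smith_normal_form (p q : nat) (A : 'M[R]_(p, q)) :
  exists (L : 'M[R]_p) (Q : 'M[R]_q) (c : seq nat),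
    [/\ L \in unitmx, Q \in unitmx, sorted leq c, all (fun x : nat => x <= n.+1)%N c &
        A = L *m diag_t p q c *m Q].
Proof.
elim: p q A => [|p IH] q A.
  by exists 1%:M, 1%:M, [::]; split; rewrite ?unitmx1 //; rewrite !flatmx0.
have [->|] := eqVneq A 0.
  exists 1%:M, 1%:M, [::]; rewrite !unitmx1; split=> //.
  rewrite mul1mx mulmx1; apply/matrixP => i j.
  by rewrite !mxE nth_nil tRX_eq0 // mul0rn.
case: q A => [|q] A; first by rewrite thinmx0 eqxx.
move=> nzA.
pose ij := [arg min_(z < (0, 0) : 'I_p.+1 * 'I_q.+1) tord (A z.1 z.2)].
pose o := tord (A ij.1 ij.2).
have ole i j : (o <= tord (A i j))%N.
  by rewrite /o /ij; case: arg_minnP => // z _ /(_ (i, j)); apply.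
have on : (o <= n)%N.
  rewrite leqNgt; apply: contra nzA => on; apply/eqP/matrixP => i j; rewrite mxE.
  by apply: truncP => s sn; rewrite coef0 tord_coef // (leq_ltn_trans sn) // (leq_trans on).
pose B := \matrix_(i, j) pi (drop_poly o (A i j)).
have AB : A = tR ^+ o *: B.
  apply/matrixP => i j; rewrite !mxE -tR_shift // => s so.
  by rewrite tord_coef // (leq_trans so).
have uB : B ij.1 ij.2 \is a GRing.unit.
  by apply: tR_unit; rewrite mxE coef_pi coef_drop_poly add0n tord_nz.
have {B AB uB nzA} : exists (L : 'M[R]_(1 + p)) (Q : 'M[R]_(1 + q)) (B : 'M[R]_(1 + p, 1 + q)),
    [/\ L \in unitmx, Q \in unitmx, B 0 0 \is a GRing.unit &
        A = tR ^+ o *: (L *m B *m Q)].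
  exists (tperm_mx ij.1 0), (tperm_mx ij.2 0), (xrow ij.1 0 (xcol ij.2 0 B)).
  rewrite !unitmx_perm; split=> //; first by rewrite [_ 0 0]mxE [xcol _ _ _ _ _]mxE !tpermR.
  rewrite xrowE xcolE !mulmxA -perm_mxM tperm2 perm_mx1 mul1mx.
  by rewrite -mulmxA -perm_mxM tperm2 perm_mx1 mulmx1.
move=> [L [Q [B [uL uQ uB ->]]]].
rewrite -[B]submxK; set b := ulsubmx B; set r := ursubmx B; set s := dlsubmx B.
have ub : b \in unitmx by rewrite unitmxE det_mx11 !mxE; rewrite !lshift0 in uB *.
have [L' [Q' [c [uL' uQ' sc ac eS]]]] := IH q (drsubmx B - s *m invmx b *m r).
have -> : block_mx b r s (drsubmx B) =
   block_mx 1%:M 0 (s *m invmx b) 1%:M *m block_mx b 0 0 (drsubmx B - s *m invmx b *m r)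
     *m block_mx 1%:M (invmx b *m r) 0 1%:M.
  rewrite !mulmx_block !mul0mx !mulmx0 !mul1mx !mulmx1 !addr0 ?add0r ?mul0mx ?addr0.
  by rewrite mulmxA mulmxV // mul1mx mulmxKV // mulmxA addrC subrK.
rewrite eS.
have -> : block_mx b 0 0 (L' *m diag_t p q c *m Q') =
   block_mx b 0 0 L' *m block_mx 1%:M 0 0 (diag_t p q c) *m block_mx 1%:M 0 0 Q'.
  by rewrite !mulmx_block !mul0mx !mulmx0 !mulmx1 !addr0 ?add0r ?mul0mx ?addr0.
exists (L *m block_mx 1%:M 0 (s *m invmx b) 1%:M *m block_mx b 0 0 L').
exists (block_mx 1%:M 0 0 Q' *m block_mx 1%:M (invmx b *m r) 0 1%:M *m Q).
exists (o :: map (fun y : nat => minn (o + y) n.+1) c); split.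
- rewrite !unitmx_mul uL !unitmxE !(@det_lblock _ 1 p) !unitrM -!unitmxE.
  by rewrite !unitmx1 ub.
- rewrite !unitmx_mul uQ !unitmxE !(@det_ublock _ 1 q) !unitrM -!unitmxE.
  by rewrite !unitmx1 uQ'.
- rewrite /= path_sortedE; last exact: leq_trans; apply/andP; split.
    by rewrite all_map; apply/allP => y _ /=; lia.
  by rewrite sorted_map; apply: sub_sorted sc => y z /=; lia.
- by rewrite /= (leq_trans on) // all_map; apply/allP => y _ /=; lia.
have -> : diag_t p.+1 q.+1 (o :: [seq minn (o + z) n.+1 | z <- c]) =
    tR ^+ o *: block_mx 1%:M 0 0 (diag_t p q c) :> 'M_(1 + p, 1 + q).
  apply/matrixP => i j; rewrite [LHS]mxE [RHS]mxE.
  case: (@split_ordP 1 p i) => i' ->; case: (@split_ordP 1 q j) => j' ->.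
  - by rewrite block_mxEul !ord1 mxE mulr1.
  - by rewrite block_mxEur !ord1 mxE mulr0.
  - by rewrite block_mxEdl !ord1 mxE mulr0.
  rewrite block_mxEdr mxE /= eqSS mulrnAr -exprD; congr (_ *+ _).
  case: (ltnP i' (size c)) => ic; last by rewrite !nth_default ?size_map // !tRX_eq0 ?leq_addl.
  rewrite (nth_map n.+1) //; case: (leqP (o + nth n.+1 c i') n.+1) => // h.
  by rewrite !tRX_eq0 // ltnW.
by rewrite -scalemxAr -scalemxAl !mulmxA.
Qed.

End TruncRing.

(** * Truncated matrices as matrices over k *)
Lemma rank_diag_mx (F : fieldType) p (d : 'rV[F]_p) :
  \rank (diag_mx d) = #|[pred i | d 0 i != 0]|.
Proof.
set P := [pred i | _].
pose S : 'M[F]_(#|P|, p) := \matrix_(a, j) (enum_val a == j)%:R.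
have SS : S *m S^T = 1%:M.
  apply/matrixP => a b; rewrite !mxE (bigD1 (enum_val a)) //= !mxE eqxx mul1r.
  rewrite big1 ?addr0; last first.
    by move=> j ja; rewrite !mxE eq_sym (negPf ja) mul0r.
  by rewrite (inj_eq enum_val_inj) eq_sym.
have rS : \rank S = #|P| by apply/eqnP/row_freeP; exists S^T.
rewrite -rS; apply/eqP; rewrite eqn_leq; apply/andP; split.
  have -> : diag_mx d = diag_mx d *m S^T *m S.
    apply/matrixP => i j; rewrite -mulmxA mul_diag_mx mxE [RHS]mxE.
    have [d0|d0] := eqVneq (d 0 i) 0; first by rewrite d0 mul0r mul0rn.
    have Pi : i \in P by [].
    rewrite mxE (bigD1 (enum_rank_in Pi i)) //= !mxE enum_rankK_in // eqxx mul1r.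
    rewrite big1 ?addr0 ?mulr_natr // => a ne; rewrite !mxE.
    case: eqP => [ai|_]; last by rewrite mul0r.
    by rewrite -(enum_valK_in Pi a) ai eqxx in ne.
  exact: mxrankM_maxr.
have -> : S = (\matrix_(a, j) ((enum_val a == j)%:R / d 0 (enum_val a))) *m diag_mx d.
  apply/matrixP => a j; rewrite mul_mx_diag !mxE.
  case: eqP => [<-|_]; last by rewrite !mul0r.
  by rewrite mul1r mulVf //; have := enum_valP a.
exact: mxrankM_maxr.
Qed.

Section Coords.
Variables (k : closedFieldType) (n : nat).
Local Notation R := (trunc_ring k n).
Local Notation pi := (in_qpoly ('X^(n.+1) : {poly k})).
Local Notation t := (tR k n).

(** Coefficients in the order of the coordinates of jets: [uncoords] reads a jet
   as a vector over the truncated ring. *)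
Definition coords p (v : 'rV[R]_p) : 'rV[k]_(p * n.+1) :=
  mxvec (\matrix_(i < p, s < n.+1) (v 0 i)`_s).

Definition uncoords p (w : 'rV[k]_(p * n.+1)) : 'rV[R]_p :=
  \row_i pi (jet_poly w i).

Lemma coordsE p (v : 'rV[R]_p) i s : vec_mx (coords v) i s = (v 0 i)`_s.
Proof. by rewrite mxvecK mxE. Qed.

Lemma coordsK p : cancel (@coords p) (@uncoords p).
Proof.
move=> v; apply/rowP => i; rewrite mxE; apply: truncP => s sn.
by rewrite coef_pi ltnS sn coef_poly ltnS sn coordsE inordK.
Qed.

Lemma uncoordsK p : cancel (@uncoords p) (@coords p).
Proof.
move=> w; rewrite /coords -[RHS]vec_mxK; congr mxvec; apply/matrixP => i s.
by rewrite !mxE coef_pi ltn_ord coef_poly ltn_ord inord_val mxE.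
Qed.

Lemma coords0 p : coords (0 : 'rV[R]_p) = 0.
Proof.
rewrite -[RHS]vec_mxK /coords; congr mxvec; apply/matrixP => i s.
by rewrite !mxE coef0.
Qed.

Lemma coordsZD p (a : k) (u v : 'rV[R]_p) :
  coords (a%:A *: u + v) = a *: coords u + coords v.
Proof.
rewrite /coords -linearP; congr mxvec; apply/matrixP => i s.
by rewrite !mxE coefD -[_ *: 1 * _]scalerAl mul1r coefZ.
Qed.

Lemma coordsD p (u v : 'rV[R]_p) : coords (u + v) = coords u + coords v.
Proof. by have := coordsZD 1 u v; rewrite !scale1r. Qed.

Definition mulT_fun p q (A : 'M[R]_(p, q)) (w : 'rV[k]_(p * n.+1)) :=
  coords (uncoords w *m A).

Fact mulT_fun_linear p q (A : 'M[R]_(p, q)) : linear (mulT_fun A).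
Proof.
move=> a u v; rewrite /mulT_fun -coordsZD scalemxAl -mulmxDl; congr (coords (_ *m _)).
by apply: (can_inj (@coordsK p)); rewrite coordsZD !uncoordsK.
Qed.

HB.instance Definition _ p q (A : 'M[R]_(p, q)) :=
  GRing.isSemilinear.Build k 'rV[k]_(p * n.+1) 'rV[k]_(q * n.+1) _ (mulT_fun A)
    (GRing.semilinear_linear (mulT_fun_linear A)).

(** The k-linear map w |-> w A in coordinates.  It converts images over the
   truncated ring into row spaces, and lengths into ranks. *)
Definition mulT p q (A : 'M[R]_(p, q)) : 'M[k]_(p * n.+1, q * n.+1) :=
  lin1_mx (mulT_fun A).

Lemma mul_coords p q (A : 'M[R]_(p, q)) v : coords v *m mulT A = coords (v *m A).
Proof. by rewrite mul_rV_lin1 /= /mulT_fun coordsK. Qed.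

Lemma mulTM p q r (A : 'M[R]_(p, q)) (B : 'M[R]_(q, r)) :
  mulT (A *m B) = mulT A *m mulT B.
Proof.
apply/row_matrixP => i; rewrite !rowE -[delta_mx _ _]uncoordsK mulmxA.
by rewrite !mul_coords mulmxA.
Qed.

Lemma mulT1 p : mulT 1%:M = 1%:M :> 'M_(p * n.+1).
Proof.
apply/row_matrixP => i; rewrite !rowE -[delta_mx _ _]uncoordsK.
by rewrite mul_coords !mulmx1.
Qed.

Lemma sub_mulT p q (A : 'M[R]_(p, q)) v :
  reflect (exists w, v = w *m A) (coords v <= mulT A)%MS.
Proof.
apply: (iffP submxP) => [[w]|[w ->]].
  rewrite -[w]uncoordsK mul_coords => /(can_inj (@coordsK q)) ->.
  by exists (uncoords w).
by exists (coords w); rewrite mul_coords.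
Qed.

Lemma mulT_unit p (A : 'M[R]_p) : A \in unitmx -> mulT A \in unitmx.
Proof.
move=> uA; have : mulT A *m mulT (invmx A) = 1%:M by rewrite -mulTM mulmxV // mulT1.
by case/mulmx1_unit.
Qed.

Lemma rank_mulT_equiv p q j (L : 'M[R]_p) (A : 'M[R]_(p, q)) (Q : 'M[R]_q) :
  L \in unitmx -> Q \in unitmx ->
  \rank (mulT (t ^+ j *: (L *m A *m Q))) = \rank (mulT (t ^+ j *: A)).
Proof.
move=> uL uQ; rewrite scalemxAl scalemxAr !mulTM.
rewrite mxrankMfree ?row_free_unit ?mulT_unit //.
by rewrite -mxrank_tr trmx_mul mxrankMfree ?mxrank_tr // row_free_unit unitmx_tr mulT_unit.
Qed.

Lemma mul_diag_tE p q (qp : (q <= p)%N) j c (w : 'rV[R]_p) i :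
  (w *m (t ^+ j *: diag_t k n p q c)) 0 i =
  t ^+ (j + nth n.+1 c i) * w 0 (widen_ord qp i).
Proof.
rewrite mxE (bigD1 (widen_ord qp i)) // big1; first rewrite [LHS]addr0.
  by rewrite !mxE eqxx mulr1n -exprD mulrC.
move=> l li; have li' : (l == i :> nat) = false by apply/negbTE.
by rewrite !mxE li' !mulr0n !mulr0.
Qed.

(** The image is spanned by the monomials t^s of the column i with
   s >= j + c_i; its matrix has the row space of a diagonal indicator matrix. *)
Lemma rank_mulT_diag p q (j : nat) (c : seq nat) : (q <= p)%N ->
  \rank (mulT (t ^+ j *: diag_t k n p q c)) =
  (\sum_(i < q) (n.+1 - (j + nth n.+1 c i)))%N.
Proof.
move=> qp; pose D : 'M[k]_(q, n.+1) := \matrix_(i, s) (j + nth n.+1 c i <= s)%N%:R.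
have -> : \rank (mulT (t ^+ j *: diag_t k n p q c)) = \rank (diag_mx (mxvec D)).
  apply/eqmx_rank/andP.
  split; apply/rV_subP => u; rewrite -[u]uncoordsK; move: (uncoords u) => v {u}.
    move=> /sub_mulT[w ->]; apply/submxP; exists (coords (w *m (t ^+ j *: diag_t k n p q c))).
    apply/rowP => z; case/mxvec_indexP: z => i s.
    rewrite mul_mx_diag mxE !mxvecE ![(\matrix_(_, _) _) _ _]mxE mul_diag_tE.
    rewrite coef_tRM; last by rewrite -ltnS.
    by case: leqP => js; rewrite ?mulr1 // mulr0.
  move=> /submxP[w /(congr1 (@uncoords q))]; rewrite coordsK => ev.
  apply/sub_mulT.
  exists (\row_(l < p) (if insub (val l) is Some i then
      pi (drop_poly (j + nth n.+1 c l) (v 0 i)) else 0)).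
  apply/rowP => i; rewrite mul_diag_tE mxE (insubT (fun l => l < q)%N (ltn_ord i)).
  rewrite (_ : Sub _ _ = i); last exact: val_inj.
  apply: tR_shift => s si; case: (ltnP n s) => sn; first exact: coef_ge.
  have /(congr1 (@coords q)) := ev; rewrite uncoordsK.
  move=> /(congr1 (fun u => vec_mx u i (inord s))); rewrite coordsE inordK // => ->.
  by rewrite mul_mx_diag !mxE mxvecE mxE inordK // leqNgt si mulr0.
rewrite rank_diag_mx -sum1_card big_mkcond (reindex _ (curry_mxvec_bij q n.+1)) /=.
rewrite -big_mkcond /=.
rewrite (eq_bigl (fun z : 'I_q * 'I_n.+1 => (j + nth n.+1 c z.1 <= z.2)%N)); last first.
  by move=> [i s]; rewrite !inE /= mxvecE mxE; case: leqP; rewrite ?oner_eq0 ?eqxx.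
rewrite -(pair_big_dep xpredT (fun (i : 'I_q) (s : 'I_n.+1) => (j + nth n.+1 c i <= s)%N)
  (fun _ _ => 1%N)) /=.
apply: eq_bigr => i _; move: (j + _)%N => a.
rewrite -(big_mkord (fun s => a <= s)%N (fun=> 1%N)).
elim: n => [|n' IH]; first by rewrite big_mkcond big_nat1; case: a => [|[]].
by rewrite big_mkcond big_nat_recr //= -big_mkcond IH; case: leqP; lia.
Qed.

End Coords.

(** * Uniqueness of the invariants *)
Lemma sorted_count_eq (c d : seq nat) : sorted leq c -> sorted leq d ->
  (forall s, count (fun x => x <= s)%N c = count (fun x => x <= s)%N d) -> c = d.
Proof.
move=> sc sd cd; apply: (sorted_eq leq_trans anti_leq) => //.
have split (u : seq nat) s : count (fun x => x <= s)%N u =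
    (count_mem s u + count (fun x => x < s)%N u)%N.
  elim: u => //= x u ->; by case: (ltngtP x s) => _ /=; lia.
apply/allP => s _ /=; have := cd s; rewrite !split.
have -> : count (fun x => x < s)%N c = count (fun x => x < s)%N d.
  by case: s => [|s]; [rewrite !(@eq_count _ _ pred0) ?count_pred0 | apply: cd].
by move=> /eqP; rewrite eqn_add2r.
Qed.

(** Subtracting the sum for j + 1 from the sum for j counts the entries that are
   at most n - j. *)
Lemma sum_defect_eq n (c d : seq nat) : sorted leq c -> sorted leq d ->
  size c = size d ->
  all (fun x => x <= n.+1)%N c -> all (fun x => x <= n.+1)%N d ->
  (forall j, (j <= n)%N ->
    (\sum_(x <- c) (n.+1 - (j + x)) = \sum_(x <- d) (n.+1 - (j + x)))%N) -> c = d.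
Proof.
move=> sc sd scd ac ad cd; apply: sorted_count_eq => // s.
case: (leqP s n) => [sn|ns]; last first.
  have full (u : seq nat) : all (fun x => x <= n.+1)%N u ->
      count (fun x => x <= s)%N u = size u.
    by move=> au; apply/eqP; rewrite -all_count; apply: sub_all au => x; lia.
  by rewrite !full.
have cnt (u : seq nat) : (\sum_(x <- u) (n.+1 - (n - s + x)) =
    count (fun x => x <= s)%N u + \sum_(x <- u) (n.+1 - ((n - s).+1 + x)))%N.
  elim: u => [|x u IH]; first by rewrite !big_nil.
  by rewrite !big_cons IH /=; case: (leqP x s); lia.
have := cd (n - s)%N (leq_subr _ _); rewrite !cnt.
case: s sn {cnt} => [|s] sn.
  rewrite subn0 => /eqP; rewrite ![(\sum_(x <- _) (n.+1 - (n.+1 + x)))%N]big1; last first.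
  - by move=> x _; lia.
  - by move=> x _; lia.
  by rewrite !addn0 => /eqP.
by rewrite cd; [move=> /eqP; rewrite eqn_add2r => /eqP | lia].
Qed.

Section PowerSubmodule.
Variables (k : closedFieldType) (N : nat).
Implicit Types (d : N.-tuple nat) (x y : 'rV[{poly k}]_N).

Lemma power0 d : power_submodule d (0 : 'rV[{poly k}]_N).
Proof. by move=> i; rewrite mxE dvdp0. Qed.

Lemma powerD d x y : power_submodule d x -> power_submodule d y ->
  power_submodule d (x + y).
Proof. by move=> dx dy i; rewrite mxE dvdp_addr. Qed.

Lemma powerZ d a x : power_submodule d x -> power_submodule d (a *: x).
Proof. by move=> dx i; rewrite mxE dvdp_mull. Qed.

Lemma powerN d x : power_submodule d x -> power_submodule d (- x).
Proof. by rewrite -scaleN1r; apply: powerZ. Qed.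

Lemma powerB d x y : power_submodule d x -> power_submodule d y ->
  power_submodule d (x - y).
Proof. by move=> dx dy; apply/powerD/powerN. Qed.

Section Hom.
Variables (d : N.-tuple nat) (h : 'rV[{poly k}]_N -> 'rV[{poly k}]_N).
Hypothesis hlin : forall a x y,
  power_submodule d (h (a *: x + y) - (a *: h x + h y)).

Lemma hom0 : power_submodule d (h 0).
Proof.
have := hlin 1 0 0; rewrite !scale1r addr0 opprD addrA subrr add0r.
by move=> /powerN; rewrite opprK.
Qed.

Lemma homZ a x : power_submodule d (h (a *: x) - a *: h x).
Proof.
have := powerD (hlin a x 0) hom0.
by rewrite addr0 opprD addrA subrK.
Qed.

Lemma hom_sum I (r : seq I) (a : I -> {poly k}) (x : I -> 'rV[{poly k}]_N) :
  power_submodule d (h (\sum_(i <- r) a i *: x i) - \sum_(i <- r) a i *: h (x i)).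
Proof.
elim: r => [|i r IH]; first by rewrite !big_nil subr0; apply: hom0.
rewrite !big_cons; have := powerD (hlin (a i) (x i) (\sum_(i <- r) a i *: x i)) IH.
by rewrite opprD !addrA subrK opprD addrA.
Qed.
End Hom.

(** The number of summands of length greater than j of M is the dimension of
   t^j M / t^(j+1) M.  Let x_i in M correspond to the i-th generator of the
   sum with exponents c, and let P be the matrix of the constant terms of the
   images of the x_i in the sum with exponents d.  If a vector a supported on the
   long summands is killed by the long columns of P, then t^j sum a_i x_i is
   divisible by t^(j+1) in M, and reading this back on the generators gives
   a = 0. *)
Lemma card_invariants_le (S : 'rV[{poly k}]_N -> Prop) (c d : N.-tuple nat) j :
  quotients_isomorphic S (@power_submodule k N c) ->
  quotients_isomorphic S (@power_submodule k N d) ->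
  (#|[pred i | (j < tnth c i)%N]| <= #|[pred i | (j < tnth d i)%N]|)%N.
Proof.
move=> [h [hS hlin hsurj]] [g [gS glin gsurj]].
have /fin_all_exists[x hx] : forall i : 'I_N, exists x, power_submodule c (delta_mx 0 i - h x).
  by move=> i; apply: hsurj.
pose ind (u : N.-tuple nat) : 'rV[k]_N := \row_i (j < tnth u i)%N%:R.
have ind_rank u : \rank (diag_mx (ind u)) = #|[pred i | (j < tnth u i)%N]|.
  rewrite rank_diag_mx; apply: eq_card => i; rewrite !inE mxE.
  by case: (_ < _)%N; rewrite ?oner_eq0 ?eqxx.
pose P : 'M[k]_N := \matrix_(i, i') (g (x i) 0 i')`_0.
rewrite -!ind_rank.
suff ker : (kermx (diag_mx (ind c) *m P *m diag_mx (ind d)) <= kermx (diag_mx (ind c)))%MS.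
  apply: leq_trans (mxrankM_maxr (diag_mx (ind c) *m P) (diag_mx (ind d))).
  by have := mxrankS ker; rewrite !mxrank_ker leq_sub2lE // rank_leq_row.
apply/rV_subP => b /sub_kermxP; rewrite !mulmxA; set a := b *m _ => aP.
have a0 i : (tnth c i <= j)%N -> a 0 i = 0.
  by move=> cj; rewrite /a mul_mx_diag !mxE ltnNge cj mulr0.
apply/sub_kermxP; rewrite -/a; clearbody a; apply/rowP => i; rewrite [RHS]mxE.
case: (ltnP j (tnth c i)) => [ci|/a0 //].
pose X := \sum_l ((a 0 l)%:P * 'X^j) *: x l.
have [z hz] : exists z, power_submodule d (g X - 'X^(j.+1) *: z).
  exists (\row_i' drop_poly 1 (\sum_l (a 0 l) *: g (x l) 0 i')).
  have := hom_sum glin (index_enum _) (fun l => (a 0 l)%:P * 'X^j) x.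
  move=> gX; rewrite -[g X](subrK (\sum_l ((a 0 l)%:P * 'X^j) *: g (x l))) -addrA.
  apply: powerD => // i'; rewrite !mxE summxE.
  set y := \sum_l a 0 l *: g (x l) 0 i'.
  have -> : \sum_l (((a 0 l)%:P * 'X^j) *: g (x l)) 0 i' = 'X^j * y.
    rewrite mulr_sumr; apply: eq_bigr => l _.
    by rewrite mxE mulrAC mulrC mul_polyC.
  rewrite exprSr -mulrA -mulrBr.
  case: (ltnP j (tnth d i')) => di; last by rewrite dvdp_mulr // dvdp_exp2l.
  have y0 : y`_0 = 0.
    have /matrixP/(_ 0 i') := aP; rewrite mul_mx_diag !mxE di mulr1 => aP0.
    by rewrite coef_sum -[RHS]aP0; apply: eq_bigr => l _; rewrite coefZ mxE.
  rewrite -{1}(poly_take_drop 1 y) (_ : take_poly 1 y = 0) ?add0r; last first.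
    by apply/polyP => -[|s]; rewrite coef_take_poly coef0 ?y0.
  by rewrite expr1 mulrC ['X * _]mulrC subrr mul0r dvdp0.
have [y hy] := gsurj z.
have : power_submodule c (h X - h ('X^(j.+1) *: y)).
  apply/hS/gS; have := powerD hz (powerZ 'X^(j.+1) hy).
  rewrite scalerBr addrA subrK => /powerB /(_ (homZ glin 'X^(j.+1) y)).
  by rewrite opprB addrA subrK.
have hX : power_submodule c (h X - \sum_l ((a 0 l)%:P * 'X^j) *: delta_mx 0 l).
  have := hom_sum hlin (index_enum _) (fun l => (a 0 l)%:P * 'X^j) x.
  move=> hX; rewrite -[h X](subrK (\sum_l ((a 0 l)%:P * 'X^j) *: h (x l))) -addrA.
  apply: powerD => //; rewrite -sumrB.
  elim/big_ind: _ => [|u v|l _]; [exact: power0 | exact: powerD |].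
  by rewrite -scalerBr -opprB scalerN; apply/powerN/powerZ.
move=> /powerB /(_ hX).
rewrite opprB addrC addrA subrK => /powerD /(_ (homZ hlin 'X^(j.+1) y)).
rewrite addrA subrK => /(_ i); rewrite !mxE summxE (bigD1 i) //= big1 ?addr0; last first.
  by move=> l li; rewrite !mxE eqxx eq_sym (negPf li) mulr0.
rewrite !mxE !eqxx mulr1 => /(dvdp_trans (dvdp_exp2l _ ci)).
rewrite dvdp_subl; last exact: dvdp_mulr.
move=> /dvdpP[q e].
have := congr1 (fun p : {poly k} => p`_j) e.
by rewrite !coefMXn ltnn ltnSn subnn coefC.
Qed.

Lemma quotients_isomorphic_inj (S : 'rV[{poly k}]_N -> Prop) (c d : N.-tuple nat) :
  sorted leq c -> sorted leq d ->
  quotients_isomorphic S (@power_submodule k N c) ->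
  quotients_isomorphic S (@power_submodule k N d) -> c = d.
Proof.
move=> sc sd ic id; apply/val_inj/sorted_count_eq => // s /=.
have cnt (u : N.-tuple nat) :
    (count (fun z : nat => z <= s)%N u + #|[pred i | (s < tnth u i)%N]|)%N = N.
  rewrite -[X in _ = X](size_tuple u) -(count_predC (fun z : nat => z <= s)%N); congr (_ + _)%N.
  rewrite cardE size_filter -enumT /= -[in RHS](map_tnth_enum u) count_map.
  by apply: eq_count => i; rewrite !inE ltnNge.
have := cnt c; have := cnt d.
have := card_invariants_le s ic id; have := card_invariants_le s id ic; lia.
Qed.

End PowerSubmodule.

(** * Ranks of the Jacobian and the strata *)
Lemma nth_default_sorted b (c : seq nat) i : sorted leq c ->
  all (fun x => x <= b)%N c -> (nth b c i <= nth b c i.+1)%N.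
Proof.
move=> sc ac; case: (ltnP i.+1 (size c)) => ic; first by move/(sortedP b): sc; apply.
rewrite (nth_default _ ic); case: (ltnP i (size c)) => ic'; last by rewrite nth_default.
by apply: (allP ac); apply: mem_nth.
Qed.

Section InvariantFactors.
Variables (k : closedFieldType) (n : nat).
Local Notation R := (trunc_ring k n).
Local Notation pi := (in_qpoly ('X^(n.+1) : {poly k})).
Local Notation t := (tR k n).

(** The rank over k of t^j times a matrix with Smith exponents e and m columns. *)
Definition expected_rank m (e : seq nat) j := (\sum_(i < m) (n.+1 - (j + nth n.+1 e i)))%N.

(** A restatement of having Smith exponents e, by [smith_has_type] and
   [has_type_smith], in terms of ranks over k.  Ranks are what makes the
   condition locally closed. *)
Definition has_type N m (A : 'M[R]_(N, m)) (e : seq nat) :=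
  forall j, (j <= n)%N -> \rank (mulT (t ^+ j *: A)) = expected_rank m e j.

Lemma has_type_inj N m (A : 'M[R]_(N, m)) (c e : seq nat) :
  size c = m -> sorted leq c -> all (fun x => x <= n.+1)%N c ->
  size e = m -> sorted leq e -> all (fun x => x <= n.+1)%N e ->
  has_type A c -> has_type A e -> c = e.
Proof.
move=> zc sc ac ze se ae tc te; apply: (@sum_defect_eq n) => //; first by rewrite zc.
move=> j jn; rewrite [LHS](big_nth n.+1) [RHS](big_nth n.+1) zc ze !big_mkord.
exact: etrans (esym (tc j jn)) (te j jn).
Qed.

Lemma smith_type N m (A : 'M[R]_(N, m)) : (m <= N)%N ->
  exists (L : 'M_N) (Q : 'M_m) (c : seq nat),
    [/\ size c = m, sorted leq c, all (fun x => x <= n.+1)%N c,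
      L \in unitmx /\ Q \in unitmx & A = L *m diag_t k n N m c *m Q].
Proof.
move=> mN; have [L [Q [c [uL uQ sc ac ->]]]] := smith_normal_form A.
exists L, Q, (mkseq (nth n.+1 c) m).
have cE i : (i < m)%N -> nth n.+1 (mkseq (nth n.+1 c) m) i = nth n.+1 c i.
  by move=> im; rewrite nth_mkseq.
have cn i : (nth n.+1 c i <= n.+1)%N.
  case: (ltnP i (size c)) => ic; last by rewrite nth_default.
  by apply: (allP ac); apply: mem_nth.
split; [by rewrite size_mkseq | | | by [] |].
- apply/(sortedP n.+1) => i; rewrite size_mkseq => im.
  by rewrite !cE //; [apply: nth_default_sorted | apply: ltnW].
- by apply/allP => x /(nthP n.+1)[i]; rewrite size_mkseq => im <-; rewrite cE.
- suff -> : diag_t k n N m (mkseq (nth n.+1 c) m) = diag_t k n N m c by [].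
  apply/matrixP => i j; rewrite [LHS]mxE [RHS]mxE; case: eqP => // ij.
  by rewrite cE // ij.
Qed.

Lemma smith_has_type N m (L : 'M[R]_N) (Q : 'M[R]_m) (c : seq nat) : (m <= N)%N ->
  L \in unitmx -> Q \in unitmx -> has_type (L *m diag_t k n N m c *m Q) c.
Proof. by move=> mN uL uQ j _; rewrite rank_mulT_equiv // rank_mulT_diag. Qed.

Lemma has_type_smith N m (A : 'M[R]_(N, m)) (e : seq nat) : (m <= N)%N ->
  size e = m -> sorted leq e -> all (fun x => x <= n.+1)%N e -> has_type A e ->
  exists (L : 'M_N) (Q : 'M_m),
    [/\ L \in unitmx, Q \in unitmx & A = L *m diag_t k n N m e *m Q].
Proof.
move=> mN ze se ae te.
have [L [Q [c [zc sc ac [uL uQ] eA]]]] := smith_type A mN.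
have tc : has_type A c by rewrite eA; apply: smith_has_type.
by exists L, Q; rewrite -(has_type_inj zc sc ac ze se ae tc te).
Qed.

Lemma map_pi0 p q (M : 'M[{poly k}]_(p, q)) : map_mx pi M = 0 ->
  exists W, M = 'X^(n.+1) *: W.
Proof.
move=> M0; exists (map_mx (fun x => x %/ 'X^(n.+1)) M); apply/matrixP => i j.
rewrite !mxE mulrC divpK //; apply/pi_eq0.
by have /matrixP/(_ i j) := M0; rewrite !mxE.
Qed.

Definition lift_mx p q (M : 'M[R]_(p, q)) : 'M[{poly k}]_(p, q) :=
  map_mx (fun x : R => x : {poly k}) M.

Lemma lift_mxK p q (M : 'M[R]_(p, q)) : map_mx pi (lift_mx M) = M.
Proof. by apply/matrixP => i j; rewrite !mxE pi_val. Qed.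

Lemma pi_Xn1 : pi 'X^(n.+1) = 0.
Proof. by apply/pi_eq0; rewrite dvdpp. Qed.

Variables (N m : nat) (f : 'I_m -> {mpoly k[N]}).

(** Transposed, so that its rows are indexed by the variables and left
   multiplication by a tangent vector gives the differential of the
   equations. *)
Definition jac l (theta : jet k N l) : 'M[R]_(N, m) :=
  (map_mx pi (jacobian f theta))^T.

Lemma jacobian_submodule_pi (theta : jet k N n) v : jacobian_submodule f theta v <->
  exists c : 'rV[R]_m, map_mx pi v = c *m (jac theta)^T.
Proof.
rewrite trmxK; split=> [[c [w ->]]|[c cv]].
  by exists (map_mx pi c); rewrite map_mxD map_mxZ [X in X *: _]pi_Xn1 scale0r addr0 map_mxM.
have [|W hW] := @map_pi0 _ _ (v - lift_mx c *m jacobian f theta).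
  by rewrite map_mxB map_mxM lift_mxK cv subrr.
by exists (lift_mx c), W; rewrite -hW addrC subrK.
Qed.

Lemma power_submodule_pi (d : N.-tuple nat) v : all (fun x => x <= n.+1)%N d ->
  power_submodule d v <->
  forall i, exists r, map_mx pi v 0 i = t ^+ tnth d i * r.
Proof.
move=> ad; have di i : (tnth d i <= n.+1)%N by apply: (allP ad); apply: mem_tnth.
split=> h i.
  case/dvdpP: (h i) => q vq; exists (pi q).
  by rewrite mxE vq tRX -rmorphM mulrC.
case: (h i) => r; rewrite mxE tRX -[r]pi_val -rmorphM => /pi_eqP.
move=> /(dvdp_trans (dvdp_exp2l _ (di i))); rewrite dvdp_subl //.
exact: dvdp_mulr.
Qed.

(** The change of basis on the side of the variables carries the span of the rows
   of the Jacobian matrix to the span of the t^(e_i) times the first unit vectors.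
   The remaining N - m exponents are n + 1 because the matrix has m rows. *)
Lemma jet_invariants_smith (theta : jet k N n) (e : seq nat) (d : N.-tuple nat) :
  (m <= N)%N -> size e = m -> sorted leq e -> all (fun x => x <= n.+1)%N e ->
  d = e ++ nseq (N - m) n.+1 :> seq nat ->
  has_type (jac theta) e -> jet_invariants f theta d.
Proof.
move=> mN se soe ae de /(has_type_smith mN se soe ae)[L [Q [uL uQ eJ]]].
have dE (i : 'I_N) : tnth d i = nth n.+1 e i.
  rewrite (tnth_nth n.+1) de nth_cat se; case: ltnP => // mi.
  by rewrite nth_nseq nth_default ?se // if_same.
have ad : all (fun x => x <= n.+1)%N d.
  by rewrite de all_cat ae /= all_nseq leqnn orbT.
split=> //.
  have dn i : nth n.+1 d i = nth n.+1 e i.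
    rewrite de nth_cat; case: ltnP => // mi.
    by rewrite nth_nseq if_same nth_default.
  by apply/(sortedP n.+1) => i _; rewrite !dn nth_default_sorted.
have uL' : L^T \in unitmx by rewrite unitmx_tr.
have uQ' : Q^T \in unitmx by rewrite unitmx_tr.
pose h (v : 'rV[{poly k}]_N) := v *m lift_mx (invmx L^T).
have hS x : jacobian_submodule f theta x <-> power_submodule d (h x).
  rewrite jacobian_submodule_pi (power_submodule_pi _ ad) map_mxM lift_mxK eJ.
  split=> [[c ->] i|hx].
    rewrite !trmx_mul !mulmxA mulmxK // mxE.
    case: (ltnP i m) => im.
      exists ((c *m Q^T) 0 (Ordinal im)).
      rewrite (bigD1 (Ordinal im)) // big1; first rewrite [LHS]addr0.
        by rewrite !mxE eqxx mulr1n dE mulrC.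
      move=> l li; have li' : (i == l :> nat) = false.
        by rewrite eq_sym; apply/negbTE.
      by rewrite !mxE li' mulr0n mulr0.
    exists 0; rewrite mulr0 big1 // => l _; rewrite !mxE.
    by rewrite gtn_eqF ?mulr0n ?mulr0 // (leq_trans (ltn_ord l)).
  have [r hr] := fin_all_exists hx.
  exists ((\row_l r (widen_ord mN l)) *m invmx Q^T).
  rewrite !trmx_mul !mulmxA mulmxKV // -[LHS](mulmxKV uL'); congr (_ *m _).
  apply/rowP => i; rewrite hr dE mxE.
  case: (ltnP i m) => im.
    rewrite (bigD1 (Ordinal im)) // big1; first rewrite [RHS]addr0.
      rewrite !mxE eqxx mulr1n mulrC; congr (r _ * _); exact: val_inj.
    move=> l li; have li' : (i == l :> nat) = false.
      by rewrite eq_sym; apply/negbTE.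
    by rewrite !mxE li' mulr0n mulr0.
  rewrite nth_default ?se // tRX_eq0 // mul0r big1 // => l _; rewrite !mxE.
  by rewrite gtn_eqF ?mulr0n ?mulr0 // (leq_trans (ltn_ord l)).
exists h; split.
- by move=> x y; rewrite hS /h mulmxBl.
- by move=> a x y; rewrite /h mulmxDl -scalemxAl subrr; apply: power0.
- move=> z; exists (z *m lift_mx L^T); apply/(power_submodule_pi _ ad) => i.
  exists 0; rewrite mulr0 /h map_mxB !map_mxM !lift_mxK mulmxK //.
  by rewrite subrr mxE.
Qed.

Lemma stratumP (e : m.-tuple nat) (theta : jet k N n) : (m <= N)%N ->
  sorted leq e -> all (fun x => x < uphalf n)%N e ->
  stratum n f e theta <-> jets (ideal_gen f) theta /\ has_type (jac theta) e.
Proof.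
move=> mN soe ae.
have ae' : all (fun x => x <= n.+1)%N e by apply: sub_all ae => x; lia.
have szd (c : seq nat) : size c = m -> size (c ++ nseq (N - m) n.+1) == N.
  by move=> sc; rewrite size_cat size_nseq sc subnKC.
split=> -[jt ty]; split=> //.
  case: ty => d [[sd ad id] de _].
  have [L [Q [c [zc sc ac [uL uQ] eJ]]]] := smith_type (jac theta) mN.
  have tc : has_type (jac theta) c by rewrite eJ; apply: smith_has_type.
  have [] := @jet_invariants_smith theta c (Tuple (szd c zc)) => //.
  move=> sc' _ /(quotients_isomorphic_inj sc' sd) /(_ id) ed.
  suff -> : tval e = c by [].
  apply: (@eq_from_nth _ 0%N); rewrite size_tuple ?zc // => i im.
  by rewrite -de // -ed /= nth_cat zc im.
exists (Tuple (szd e (size_tuple e))); split.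
- by apply: jet_invariants_smith ty => //; rewrite size_tuple.
- by move=> i im; rewrite /= nth_cat size_tuple im.
- move=> mN'; rewrite /= nth_cat size_tuple ltnn subnn nth_nseq subn_gt0 mN'.
  by lia.
Qed.
End InvariantFactors.

(** * Taylor expansion and perturbation of images *)
Section Taylor.
Variables (k : closedFieldType) (N : nat) (x y : 'I_N -> {poly k}) (s : {poly k}).

Local Notation ev := (mmap (@polyC k)).

(** The polynomials that satisfy the formula contain the constants and the
   variables and are stable under sums and, by the Leibniz rule, products. *)
Lemma taylor (p : {mpoly k[N]}) : exists h : {poly k},
  ev (fun i => x i + s * y i) p =
  ev x p + s * (\sum_j y j * ev x (mderiv j p)) + s * s * h.
Proof.
pose z i := x i + s * y i.
pose D p := \sum_j y j * ev x (mderiv j p).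
pose P p := exists h : {poly k}, ev z p = ev x p + s * D p + s * s * h.
have PC c : P c%:MP.
  exists 0; rewrite mulr0 addr0 /D !mmapC big1 ?mulr0 ?addr0 // => j _.
  by rewrite mderivC mmap0 mulr0.
have PX i : P 'X_i.
  exists 0; rewrite mulr0 addr0 /D !mmapX !mmap1U /z; congr (_ + s * _).
  rewrite (bigD1 i) //= big1 ?addr0.
    rewrite mderivX mnm1E eqxx scale1r (_ : (_ - _)%MM = 0%MM).
      by rewrite mmapX mmap11 mulr1.
    by apply/mnmP => l; rewrite mnmBE mnm0E subnn.
  move=> j ji; by rewrite mderivX mnm1E eq_sym (negPf ji) scale0r mmap0 mulr0.
have PD u v : P u -> P v -> P (u + v).
  move=> [h hp] [h' hq]; exists (h + h'); rewrite !mmapD hp hq.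
  have -> : D (u + v) = D u + D v.
    by rewrite /D -big_split; apply: eq_bigr => j _; rewrite mderivD mmapD mulrDr.
  ring.
have PM u v : P u -> P v -> P (u * v).
  move=> [h hp] [h' hq].
  exists (D u * D v + h * (ev x v + s * D v) + h' * (ev x u + s * D u) + s * s * h * h').
  rewrite !rmorphM /= hp hq.
  have -> : D (u * v) = D u * ev x v + ev x u * D v.
    rewrite /D mulr_suml mulr_sumr -big_split; apply: eq_bigr => j _ /=.
    by rewrite mderivM mmapD !rmorphM /= mulrDr mulrA mulrCA.
  ring.
suff : P p by [].
elim/mpolyind: p => [|c m p _ _ Pp]; first by rewrite -(mpolyC0 N k).
apply: (PD) => //; rewrite -mul_mpolyC; apply: (PM) => //; rewrite mpolyXE_id.
apply: (big_ind P) => [|u v|i _]; [by rewrite -(mpolyC1 N k) | exact: PM |].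
elim: (m i) => [|a IH]; first by rewrite expr0 -(mpolyC1 N k).
by rewrite exprS; apply: PM.
Qed.

End Taylor.

Section Matrices.
Variables (k : closedFieldType) (n : nat).
Local Notation R := (trunc_ring k n).
Local Notation t := (tR k n).

(** Each t^(e_i) divides t^b. *)
Lemma image_contains_power N m (A : 'M[R]_(N, m)) (e : seq nat) b : (m <= N)%N ->
  size e = m -> sorted leq e -> all (fun x => x <= n.+1)%N e ->
  all (fun x => x <= b)%N e -> has_type A e ->
  forall p (M : 'M[R]_(p, m)), exists W : 'M[R]_(p, N), t ^+ b *: M = W *m A.
Proof.
move=> mN ze se ae be /(has_type_smith mN ze se ae)[L [Q [uL uQ ->]]] p M.
suff [W hW] : exists W, t ^+ b *: (M *m invmx Q) = W *m diag_t k n N m e.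
  exists (W *m invmx L); rewrite !mulmxA mulmxKV // -hW -scalemxAl mulmxKV //.
pose W : 'M[R]_(p, N) := \matrix_(i, j) (if (insub (val j) : option 'I_m) is Some l
  then t ^+ (b - nth n.+1 e l) * (M *m invmx Q) i l else 0).
exists W; apply/matrixP => r i.
have := @mul_diag_tE k n N m mN 0 e (row r W) i.
rewrite expr0 scale1r -row_mul mxE => ->; rewrite [LHS]mxE [X in _ = _ * X]mxE [X in _ = _ * X]mxE.
rewrite (insubT (fun l => l < m)%N (ltn_ord i)) (_ : Sub _ _ = i); last exact: val_inj.
rewrite mulrA -exprD add0n subnKC //.
by apply: (allP be); apply: mem_nth; rewrite ze.
Qed.

(** A right inverse modulo t^(s+1) with error t^(s+1) C is improved by the factor
   1 - t^(s+1) C, which squares the error; t^(n+1) vanishes. *)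
Lemma unipotent_unit N (W : 'M[R]_N) : 1%:M + t *: W \in unitmx.
Proof.
suff H s : exists V C : 'M_N, (1%:M + t *: W) *m V = 1%:M + t ^+ s.+1 *: C.
  have [V [C]] := H n; rewrite tRX_eq0 // scale0r addr0.
  by case/mulmx1_unit.
elim: s => [|s [V [C VC]]]; first by exists 1%:M, W; rewrite mulmx1 expr1.
exists (V *m (1%:M - t ^+ s.+1 *: C)), (- (t ^+ s *: (C *m C))).
rewrite mulmxA VC mulmxBr mulmx1 mulmxDl mul1mx -scalemxAl -scalemxAr scalerA.
rewrite opprD addrA addrK scalerN scalerA -exprD -exprD; congr (_ - t ^+ _ *: _).
lia.
Qed.

(** Since t^b E = W A for some W, the perturbed matrix is (1 + t W) A. *)
Lemma has_type_perturb N m (A E : 'M[R]_(N, m)) (e : seq nat) b : (m <= N)%N ->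
  size e = m -> sorted leq e -> all (fun x => x <= n.+1)%N e ->
  all (fun x => x <= b)%N e -> has_type A e ->
  exists2 U : 'M[R]_N, U \in unitmx & A + t ^+ b.+1 *: E = U *m A.
Proof.
move=> mN ze se ae be te; have [W hW] := image_contains_power mN ze se ae be te E.
exists (1%:M + t *: W); first exact: unipotent_unit.
by rewrite mulmxDl mul1mx -scalemxAl -hW scalerA (exprS t).
Qed.

Lemma eqmx_mulT_unit N m (U : 'M[R]_N) (A : 'M[R]_(N, m)) j : U \in unitmx ->
  (mulT (t ^+ j *: (U *m A)) :=: mulT (t ^+ j *: A))%MS.
Proof.
by move=> uU; rewrite scalemxAr mulTM; apply: eqmxMfull; rewrite row_full_unit mulT_unit.
Qed.

Lemma has_type_unit N m (U : 'M[R]_N) (A : 'M[R]_(N, m)) (e : seq nat) : U \in unitmx ->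
  has_type (U *m A) e <-> has_type A e.
Proof.
move=> uU; split=> te j jn; have [er _] := eqmx_mulT_unit A j uU.
  exact: etrans (esym er) (te j jn).
exact: etrans er (te j jn).
Qed.

(** The inclusion of the constant vectors among the vectors over the truncated
   ring, in coordinates. *)
Definition cst_mx N : 'M[k]_(N, N * n.+1) := \matrix_(i < N) coords (delta_mx 0 i : 'rV[R]_N).

Definition cst_vec N (v : 'rV[k]_N) : 'rV[R]_N := map_mx (in_alg R) v.

Lemma mul_cst_mx N (v : 'rV[k]_N) : v *m cst_mx N = coords (cst_vec v).
Proof.
apply/rowP => z; case/mxvec_indexP: z => i s; rewrite mxvecE !mxE coefZ.
rewrite (bigD1 i) //= big1 ?addr0.
  by rewrite !mxE mxvecE !mxE !eqxx.
by move=> l li; rewrite !mxE mxvecE !mxE eqxx eq_sym (negPf li) coef0 mulr0.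
Qed.

(** Every vector is a constant vector plus t times a vector, so t^j Im A is
   t^(j+1) Im A together with the image under t^j A of the constant vectors: the
   latter produce the linear equations of the fibres. *)
Lemma image_constant_split N m (A : 'M[R]_(N, m)) j :
  (mulT (t ^+ j *: A) :=: col_mx (mulT (t ^+ j.+1 *: A)) (cst_mx N *m mulT (t ^+ j *: A)))%MS.
Proof.
apply/eqmxP; apply/andP; split.
  apply/rV_subP => u; rewrite -[u]uncoordsK => /sub_mulT[w ->].
  pose w0 : 'rV[k]_N := \row_i (w 0 i)`_0.
  pose w1 : 'rV[R]_N := \row_i in_qpoly ('X^(n.+1)) (drop_poly 1 (w 0 i)).
  have -> : w = cst_vec w0 + t *: w1.
    apply/rowP => i; rewrite !mxE.
    apply: truncP => s sn; rewrite coefD coefZ -[t]expr1 coef_tRM // coef_pi coef_drop_poly.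
    rewrite -[1](rmorph1 (in_qpoly ('X^(n.+1) : {poly k}))) coef_pi coef1 ltnS sn.
    case: s sn => [|s] sn; first by rewrite mulr1 addr0.
    by rewrite mulr0 add0r subn1 /= ltnS (ltnW sn) addn1.
  rewrite mulmxDl coordsD -addsmxE addrC; apply: addmx_sub_adds.
    apply/sub_mulT; exists w1; rewrite -scalemxAl -!scalemxAr scalerA -exprS //.
  by rewrite -mul_coords -mul_cst_mx -mulmxA submxMl.
rewrite -addsmxE addsmx_sub submxMl andbT.
have -> : t ^+ j.+1 *: A = t%:M *m (t ^+ j *: A) by rewrite mul_scalar_mx scalerA -exprS.
by rewrite mulTM submxMl.
Qed.

End Matrices.

(** * Lifting jets step by step *)
Section Jets.
Variables (k : closedFieldType) (N : nat).

Lemma coef_jet_poly l (x : jet k N l) i s :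
  (jet_poly x i)`_s = if (s < l.+1)%N then vec_mx x i (inord s) else 0.
Proof. exact: coef_poly. Qed.

Lemma jet_poly_mxvec l (G : 'I_N -> nat -> k) i :
  jet_poly (mxvec (\matrix_(i < N, j < l.+1) G i j) : jet k N l) i = \poly_(j < l.+1) G i j.
Proof.
apply/polyP => s; rewrite coef_jet_poly coef_poly; case: ltnP => // sl.
by rewrite mxvecK mxE inordK.
Qed.

Lemma jet_poly_inj l (x y : jet k N l) : (forall i, jet_poly x i = jet_poly y i) -> x = y.
Proof.
move=> xy; apply: (can_inj (@vec_mxK _ _ _)); apply/matrixP => i s.
have := congr1 (fun p : {poly k} => p`_s) (xy i).
by rewrite !coef_jet_poly ltn_ord inord_val.
Qed.

Lemma jet_poly_trunc l j (x : jet k N l) i :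
  jet_poly (trunc j x) i = take_poly j.+1 (jet_poly x i).
Proof. by rewrite /trunc (jet_poly_mxvec _ (fun i s => (jet_poly x i)`_s)). Qed.

Lemma trunc_trunc l j j' (x : jet k N l) : (j' <= j)%N ->
  trunc j' (trunc j x) = trunc j' x.
Proof.
move=> jj; apply: jet_poly_inj => i; rewrite !jet_poly_trunc.
apply/polyP => s; rewrite !coef_take_poly; case: ltnP => // sj.
by rewrite ltnS (leq_trans _ jj).
Qed.

Lemma trunc_id l (x : jet k N l) : trunc l x = x.
Proof.
apply: jet_poly_inj => i; rewrite jet_poly_trunc; apply/polyP => s.
by rewrite coef_take_poly !coef_jet_poly; case: ltnP.
Qed.

Lemma jet_poly_split l j (x : jet k N l) i :
  jet_poly x i = jet_poly (trunc j x) i + 'X^(j.+1) * drop_poly j.+1 (jet_poly x i).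
Proof. by rewrite jet_poly_trunc mulrC poly_take_drop. Qed.

Definition top l (x : jet k N l.+1) : 'rV[k]_N := \row_i (jet_poly x i)`_(l.+1).

Definition ext l (z : 'rV[k]_(N * l.+1 + N)) : jet k N l.+1 :=
  mxvec (\matrix_(i < N, j < l.+2)
    (if (j <= l)%N then (jet_poly (lsubmx z : jet k N l) i)`_j else rsubmx z 0 i)).

Lemma jet_poly_top l (x : jet k N l.+1) i :
  jet_poly x i = jet_poly (trunc l x) i + 'X^(l.+1) * (top x 0 i)%:P.
Proof.
rewrite {1}(jet_poly_split l x i); congr (_ + _ * _); apply/polyP => s.
rewrite coef_drop_poly coefC mxE; case: s => [|s] /=; first by rewrite add0n.
by rewrite coef_jet_poly ifF //; apply/negbTE; lia.
Qed.

Lemma trunc_top_ext l (z : 'rV[k]_(N * l.+1 + N)) : row_mx (trunc l (ext z)) (top (ext z)) = z.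
Proof.
have e i : jet_poly (ext z) i = \poly_(j < l.+2)
    (if (j <= l)%N then (jet_poly (lsubmx z : jet k N l) i)`_j else rsubmx z 0 i).
  exact: (jet_poly_mxvec _ (fun i j => if (j <= l)%N then
             (jet_poly (lsubmx z : jet k N l) i)`_j else rsubmx z 0 i)).
rewrite -[RHS]hsubmxK; congr row_mx.
  apply: jet_poly_inj => i; rewrite jet_poly_trunc e; apply/polyP => s.
  rewrite coef_take_poly coef_poly !ltnS; case: (leqP s l) => sl; first by rewrite leqW.
  by rewrite coef_jet_poly ltnS leqNgt sl.
by apply/rowP => i; rewrite mxE e coef_poly ltnSn ltnn.
Qed.

Lemma ext_trunc_top l (x : jet k N l.+1) : ext (row_mx (trunc l x) (top x)) = x.
Proof.
have := trunc_top_ext (row_mx (trunc l x) (top x)) => /eq_row_mx[e1 e2].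
by apply: jet_poly_inj => i; rewrite !jet_poly_top e1 e2.
Qed.

End Jets.

Section JetEquations.
Variables (k : closedFieldType) (n N m : nat) (f : 'I_m -> {mpoly k[N]}).
Local Notation R := (trunc_ring k n).
Local Notation pi := (in_qpoly ('X^(n.+1) : {poly k})).
Local Notation t := (tR k n).

Definition eqs l (x : jet k N l) : 'rV[R]_m := \row_i pi (jet_eval x (f i)).

Lemma mmap_eq (g h : 'I_N -> {poly k}) p : g =1 h ->
  mmap (@polyC k) g p = mmap (@polyC k) h p.
Proof. by move=> gh; apply: eq_bigr => j _; rewrite (mmap1_eq _ gh). Qed.

Lemma taylor_eqs l l' (x : jet k N l) (x' : jet k N l') a (y : 'I_N -> {poly k}) :
  (forall i, jet_poly x' i = jet_poly x i + 'X^a * y i) ->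
  exists h, eqs x' = eqs x + t ^+ a *: ((\row_i pi (y i)) *m jac n f x) + t ^+ (a + a) *: h.
Proof.
move=> x'E.
have /fin_all_exists[h hE] : forall i : 'I_m, exists h, jet_eval x' (f i) =
   jet_eval x (f i) + 'X^a * (\sum_j y j * jet_eval x (mderiv j (f i))) + 'X^a * 'X^a * h.
  by move=> i; rewrite /jet_eval (mmap_eq _ x'E); apply: taylor.
exists (\row_i pi (h i)); apply/rowP => i.
rewrite !mxE hE !rmorphD /= !rmorphM /= -!tRX exprD; congr (_ + _ * _ + _).
by rewrite rmorph_sum; apply: eq_bigr => j _; rewrite !mxE rmorphM.
Qed.

Lemma jac_congr l l' (x : jet k N l) (x' : jet k N l') a (y : 'I_N -> {poly k}) :
  (forall i, jet_poly x' i = jet_poly x i + 'X^a * y i) ->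
  exists E, jac n f x' = jac n f x + t ^+ a *: E.
Proof.
move=> x'E.
have /fin_all_exists[h hE] : forall z : 'I_N * 'I_m, exists h,
    jet_eval x' (mderiv z.1 (f z.2)) = jet_eval x (mderiv z.1 (f z.2)) + 'X^a * h.
  move=> z; have [h hE] := taylor (jet_poly x) y 'X^a (mderiv z.1 (f z.2)).
  exists (\sum_j y j * jet_eval x (mderiv j (mderiv z.1 (f z.2))) + 'X^a * h).
  by rewrite /jet_eval (mmap_eq _ x'E) hE mulrDr addrA mulrA.
exists (\matrix_(i, j) pi (h (i, j))); apply/matrixP => i j.
by rewrite !mxE (hE (i, j)) rmorphD /= rmorphM /= -tRX.
Qed.

Lemma jets_eqs (x : jet k N n) : jets (ideal_gen f) x <-> eqs x = 0.
Proof.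
split=> [jx|x0 p [c ->]].
  apply/rowP => i; rewrite !mxE; apply/pi_eq0/jx.
  exists (fun j => (j == i)%:R); rewrite (bigD1 i) //= eqxx mul1r big1 ?addr0 //.
  by move=> j /negPf ->; rewrite mul0r.
apply/pi_eq0; rewrite /jet_eval [mmap _ _ _]raddf_sum rmorph_sum big1 // => i _.
rewrite /= [mmap _ _ _]rmorphM rmorphM /=.
by have /rowP/(_ i) := x0; rewrite !mxE => ->; rewrite mulr0.
Qed.

Variables (e : m.-tuple nat) (b : nat).
Hypotheses (mN : (m <= N)%N) (se : sorted leq e).
Hypotheses (ae : all (fun x => x <= n.+1)%N e) (be : all (fun x => x <= b)%N e).

Let ze : size e = m. Proof. exact: size_tuple. Qed.

(** Beyond level b the coefficients of a jet change its Jacobian matrix only by an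
   invertible factor. *)
Lemma jac_trunc l (x : jet k N l) : has_type (jac n f (trunc b x)) e ->
  exists2 U : 'M[R]_N, U \in unitmx & jac n f x = U *m jac n f (trunc b x).
Proof.
move=> te; have [E ->] := jac_congr (jet_poly_split b x).
exact: has_type_perturb te.
Qed.

Lemma has_type_trunc l (x : jet k N l) :
  has_type (jac n f (trunc b x)) e <-> has_type (jac n f x) e.
Proof.
split=> te; first by have [U uU ->] := jac_trunc te; apply/has_type_unit.
have [E eE] := jac_congr (jet_poly_split b x).
have [U uU eU] := has_type_perturb (- E) mN ze se ae be te.
have : jac n f (trunc b x) = U *m jac n f x by rewrite -eU eE scalerN addrK.
by move=> ->; apply/has_type_unit.
Qed.

(** By [stratum_imageP] these are the l-jets that lift to the stratum.  The
   equations are only required to hold modulo t^(l+1) times the image of the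
   Jacobian matrix, an error that the coefficients above t^l can absorb.  The
   Jacobian matrix is taken at the truncation at level b so that the linear data
   only depend on it. *)
Definition liftable l (x : jet k N l) :=
  has_type (jac n f (trunc b x)) e /\
  (coords (eqs x) <= mulT (t ^+ l.+1 *: jac n f (trunc b x)))%MS.

(** The effect on the equations of a change of the coefficients of t^(l+1), to
   first order. *)
Definition step_mx l (x : jet k N l) : 'M[k]_(N, m * n.+1) :=
  cst_mx k n N *m mulT (t ^+ l.+1 *: jac n f (trunc b x)).

(** Two terms of the Taylor expansion are dropped: the quadratic one, of order
   2l + 2 >= l + 2 + b, and the effect of truncating the Jacobian matrix at level
   b, of order (l + 1) + (b + 1).  Both are t^(l+2) t^b times a vector, and hence
   in t^(l+2) times the image. *)
Lemma eqs_step l (x : jet k N l.+1) : (b <= l)%N ->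
  has_type (jac n f (trunc b x)) e ->
  (coords (eqs x) - (coords (eqs (trunc l x)) + top x *m step_mx (trunc l x))
    <= mulT (t ^+ l.+2 *: jac n f (trunc b x)))%MS.
Proof.
move=> bl te.
have [h ->] := taylor_eqs (jet_poly_top x).
have [E eE] := jac_congr (jet_poly_split b (trunc l x)).
rewrite trunc_trunc // in eE.
rewrite /step_mx trunc_trunc // mulmxA mul_cst_mx mul_coords.
have -> : \row_i pi (top x 0 i)%:P = cst_vec n (top x).
  by apply/rowP => i; rewrite !mxE -alg_polyC linearZ /= rmorph1.
rewrite -coordsD.
have [W hW] := image_contains_power mN ze se ae be te
   (cst_vec n (top x) *m E + t ^+ (l - b) *: h).
have -> u v : coords u - coords v = coords (u - v) :> 'rV_(m * n.+1).
  by apply/eqP; rewrite subr_eq -coordsD subrK.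
apply/sub_mulT; exists W; rewrite -[RHS]scalemxAr -hW eE.
rewrite mulmxDr !scalerDr -!scalemxAr !scalerA -!exprD.
(* The exponents of both remainders, from which t^(l+2) t^b was split off. *)
rewrite (_ : (l.+2 + (b + (l - b)))%N = (l.+1 + l.+1)%N); last by lia.
rewrite (_ : (l.+2 + b)%N = (l.+1 + b.+1)%N); last by lia.
have cancel4 (V : zmodType) (u v w z : V) : u + (v + w) + z - (u + v) = w + z.
  by rewrite addrA -(addrA (u + v)) addrAC subrr add0r.
exact: cancel4.
Qed.

Lemma image_next_le N' (A : 'M[R]_(N', m)) j : (mulT (t ^+ j.+1 *: A) <= mulT (t ^+ j *: A))%MS.
Proof.
rewrite (image_constant_split A j) -addsmxE; exact: addsmxSl.
Qed.

Lemma step_mx_le l (x : jet k N l) :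
  (step_mx x <= mulT (t ^+ l.+1 *: jac n f (trunc b x)))%MS.
Proof. exact: submxMl. Qed.

Lemma sub_step_mx l (x : jet k N l) (v : 'rV[k]_(m * n.+1)) :
  (v <= mulT (t ^+ l.+1 *: jac n f (trunc b x)))%MS =
  (v <= col_mx (mulT (t ^+ l.+2 *: jac n f (trunc b x))) (step_mx x))%MS.
Proof. by have [_ h] := image_constant_split (jac n f (trunc b x)) l.+1; case: (h _ v). Qed.

Lemma liftable_step l (x : jet k N l.+1) : (b <= l)%N ->
  liftable x <-> liftable (trunc l x) /\
    ((coords (eqs (trunc l x)) + top x *m step_mx (trunc l x))%R
       <= mulT (t ^+ l.+2 *: jac n f (trunc b x)))%MS.
Proof.
move=> bl; rewrite /liftable (trunc_trunc x bl); split=> [[te eqx]|[[te eqg] eqx]].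
  have st := eqs_step bl te.
  have sx : ((coords (eqs (trunc l x)) + top x *m step_mx (trunc l x))%R
       <= mulT (t ^+ l.+2 *: jac n f (trunc b x)))%MS.
    rewrite -[(_ + _)%R](subKr (coords (eqs x))).
    by rewrite addmx_sub // eqmx_opp.
  split; last exact: sx.
  split; first exact: te.
  rewrite -[coords _](addrK (top x *m step_mx (trunc l x))).
  apply: addmx_sub; first exact: submx_trans sx (image_next_le _ _).
  rewrite eqmx_opp; apply: submx_trans (submxMl _ _) _.
  by have := step_mx_le (trunc l x); rewrite (trunc_trunc x bl).
split; first exact: te.
have st := eqs_step bl te.
rewrite -[coords _](subrK (coords (eqs (trunc l x)) + top x *m step_mx (trunc l x))).
by apply: addmx_sub; [exact: st | exact: eqx].
Qed.

(** By [image_constant_split] the error of x is the effect of a constant vector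
   up to t^(l+2) times the image; minus this vector gives the next
   coefficients. *)
Lemma liftable_lift l (x : jet k N l) : (b <= l)%N -> liftable x ->
  exists y : jet k N l.+1, trunc l y = x /\ liftable y.
Proof.
move=> bl lx; have [te] := lx; rewrite sub_step_mx => /submxP[w].
rewrite -[w]hsubmxK mul_row_col => ex.
have /eq_row_mx[e1 e2] := trunc_top_ext (row_mx x (- rsubmx w)).
exists (ext (row_mx x (- rsubmx w))); split; first exact: e1.
apply: (liftable_step _ bl).2; rewrite e1 e2; split; first exact: lx.
rewrite -(trunc_trunc (ext (row_mx x (- rsubmx w))) bl) e1 ex mulNmx addrK; exact: submxMl.
Qed.

Hypothesis he : all (fun x => x < uphalf n)%N e.

Lemma liftable_stratum (x : jet k N n) : stratum n f e x <-> liftable x.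
Proof.
have [sx1 sx2] := stratumP f x mN se he.
have T0 (v : 'rV[R]_m) (A : 'M[R]_(N, m)) : (coords v <= mulT (t ^+ n.+1 *: A))%MS <-> v = 0.
  split=> [/sub_mulT[w ->]|->]; first by rewrite tRX_eq0 // scale0r mulmx0.
  by rewrite coords0 sub0mx.
split=> [/sx1[jx te]|[te eqx]].
  by split; [apply/has_type_trunc | apply/T0/jets_eqs].
apply: sx2; split; last exact: ((has_type_trunc x).1 te).
apply: (jets_eqs x).2.
exact: ((T0 _ _).1 eqx).
Qed.

(** Descending induction on l, which starts from l = n where t^(n+1) = 0. *)
Lemma stratum_imageP l (x : jet k N l) : (b <= l <= n)%N ->
  stratum_image n f e l x <-> liftable x.
Proof.
move=> /andP[bl ln]; move En : (n - l)%N => d.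
elim: d l x bl ln En => [|d IH] l x bl ln En.
  have e0 : l = n by lia.
  subst l; rewrite -liftable_stratum; split=> [[th sth <-]|sx]; first by rewrite trunc_id.
  by exists x; rewrite ?trunc_id.
have IHl y := IH l.+1 y (leqW bl) ltac:(lia) ltac:(lia).
split=> [[th sth <-]|lx].
  have /IHl lth : stratum_image n f e l.+1 (trunc l.+1 th) by exists th.
  have [lth' _] := (liftable_step _ bl).1 lth.
  by rewrite (trunc_trunc th (leqnSn l)) in lth'.
have [y [yx /IHl[th sth thy]]] := liftable_lift bl lx.
by exists th; [exact: sth | rewrite -yx -thy (trunc_trunc th (leqnSn l))].
Qed.

End JetEquations.

(** * Dimensions of the fibres *)
Section Combinatorics.

Lemma nth_lt_count (e : seq nat) v i : sorted leq e -> (i < size e)%N ->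
  (nth 0%N e i < v)%N = (i < count (fun x => x < v)%N e)%N.
Proof.
elim: e i => // x e IH [|i] /= se ie.
  case: (ltnP x v) => xv //=; rewrite add0n; apply/esym/negbTE; rewrite -leqNgt leqn0.
  rewrite -[_ == _]negbK -lt0n -has_count; apply/negP => /hasP[y ye yv].
  by have := allP (order_path_min leq_trans se) y ye; lia.
rewrite IH ?(path_sorted se) //; case: (ltnP x v) => xv //=; rewrite add0n.
suff -> : count (fun x => x < v)%N e = 0%N by [].
apply/eqP; rewrite -[_ == _]negbK -lt0n -has_count; apply/negP => /hasP[y ye yv].
by have := allP (order_path_min leq_trans se) y ye; lia.
Qed.

Lemma max_expo m (e : m.-tuple nat) v : sorted leq e -> (0 < v)%N ->
  \max_(a < m.+1 | (expo e a < v)%N) a = count (fun x => x < v)%N e.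
Proof.
move=> se v0; apply/eqP; rewrite eqn_leq; apply/andP; split.
  apply/bigmax_leqP => -[[|a] am] //=; rewrite /expo /= => ev.
  by rewrite -nth_lt_count ?size_tuple.
have cm : (count (fun x => x < v)%N e < m.+1)%N.
  by rewrite ltnS -[X in (_ <= X)%N](size_tuple e) count_size.
apply: (@leq_bigmax_cond _ _ (fun a : 'I_m.+1 => a : nat) (Ordinal cm)).
rewrite /expo /=; case Ec : (count _ _) => [|c] //=.
by rewrite nth_lt_count ?Ec // size_tuple; rewrite Ec in cm.
Qed.

Lemma expected_rankE n m (e : m.-tuple nat) j :
  expected_rank n m e j = (\sum_(x <- e) (n.+1 - (j + x)))%N.
Proof. by rewrite [RHS](big_nth n.+1) big_mkord size_tuple. Qed.

Lemma expected_rank_top n m (e : m.-tuple nat) j : (n < j)%N -> expected_rank n m e j = 0%N.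
Proof. by move=> nj; rewrite expected_rankE big1 // => x _; lia. Qed.

(** This difference is the number of independent equations on the coefficients of
   t^(l+1), and the exponent e_i contributes to it exactly when
   e_i < n - l. *)
Lemma expected_rank_step n m (e : m.-tuple nat) l : sorted leq e -> (l < n)%N ->
  expected_rank n m e l.+1 =
  (expected_rank n m e l.+2 + \max_(a < m.+1 | (expo e a < n - l)%N) a)%N.
Proof.
move=> se ln; rewrite max_expo ?subn_gt0 // !expected_rankE -sum1_count [X in (_ + X)%N]big_mkcond.
rewrite -big_split; apply: eq_bigr => x _ /=; case: ltnP; lia.
Qed.

Lemma expo_max m (e : m.-tuple nat) : sorted leq e -> all (fun x => x <= expo e m)%N e.
Proof.
move=> se; apply/(all_nthP 0%N) => i; rewrite size_tuple /expo => im.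
case: m e se im => // m e se im /=.
by apply: (sorted_leq_nth leq_trans leqnn) => //; rewrite inE size_tuple.
Qed.

Lemma expo_le_sum m (e : m.-tuple nat) : (expo e m <= \sum_(x <- e) x)%N.
Proof.
case: m e => [|m] e; first by rewrite /expo.
rewrite /expo /= (big_nth 0%N) size_tuple big_mkord (bigD1 ord_max) //=.
exact: leq_addr.
Qed.

(** The sum telescopes by [expected_rank_step]. *)
Lemma sum_fibre_dimensions n m N (e : m.-tuple nat) l j : sorted leq e -> (m <= N)%N ->
  (l <= j <= n)%N ->
  (\sum_(l <= i < j) (N - \max_(a < m.+1 | (expo e a < n - i)%N) a) + expected_rank n m e l.+1 =
   N * (j - l) + expected_rank n m e j.+1)%N.
Proof.
move=> se mN /andP[lj]; elim: j lj => [|j IH].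
  by rewrite leqn0 => /eqP -> _; rewrite big_geq // subnn muln0.
rewrite leq_eqVlt => /predU1P[<- _|lj jn]; first by rewrite big_geq // subnn muln0.
rewrite big_nat_recr //= addnAC IH //; last exact: ltnW.
rewrite (expected_rank_step se jn); set a := \max_(_ < _ | _) _.
have : (a <= m)%N by apply/bigmax_leqP => -[i im] _ /=.
rewrite subSn // mulnS; lia.
Qed.

End Combinatorics.

(** * Polynomial dependence on the jet *)
Section Polynomiality.
Variables (k : closedFieldType) (d : nat).

(** Families of polynomials in t, and below of elements of the truncated ring,
   whose coefficients are polynomial functions of the parameter. *)
Definition poly_polyfun (G : 'rV[k]_d -> {poly k}) := forall s, polyfun (fun x => (G x)`_s).

Lemma poly_polyfun_ext G G' : G =1 G' -> poly_polyfun G -> poly_polyfun G'.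
Proof. by move=> GG' cG s; apply: polyfun_ext (cG s) => x; rewrite GG'. Qed.

Lemma poly_polyfun_cst p : poly_polyfun (fun=> p).
Proof. by move=> s; apply: polyfun_cst. Qed.

Lemma poly_polyfunM G G' : poly_polyfun G -> poly_polyfun G' -> poly_polyfun (fun x => G x * G' x).
Proof.
move=> cG cG' s.
apply: (@polyfun_ext _ _ (fun x => \sum_(i < s.+1) (G x)`_i * (G' x)`_(s - i))).
  by move=> x; rewrite coefM.
by apply: polyfun_sum => i; apply: polyfunM.
Qed.

Lemma poly_polyfun_sum I (r : seq I) (P : pred I) G :
  (forall i, poly_polyfun (G i)) -> poly_polyfun (fun x => \sum_(i <- r | P i) G i x).
Proof.
move=> cG s; apply: (@polyfun_ext _ _ (fun x => \sum_(i <- r | P i) (G i x)`_s)).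
  by move=> x; rewrite coef_sum.
by apply: polyfun_sum => i; apply: cG.
Qed.

Lemma poly_polyfun_prod I (r : seq I) (P : pred I) G :
  (forall i, poly_polyfun (G i)) -> poly_polyfun (fun x => \prod_(i <- r | P i) G i x).
Proof.
move=> cG; elim: r => [|i r IH].
  by apply: poly_polyfun_ext (poly_polyfun_cst 1) => x; rewrite big_nil.
case Pi: (P i); last by apply: poly_polyfun_ext IH => x; rewrite big_cons Pi.
by apply: poly_polyfun_ext (poly_polyfunM (cG i) IH) => x; rewrite big_cons Pi.
Qed.

Lemma poly_polyfunX G a : poly_polyfun G -> poly_polyfun (fun x => G x ^+ a).
Proof.
move=> cG; elim: a => [|a IH]; first exact: poly_polyfun_cst.
by apply: poly_polyfun_ext (poly_polyfunM cG IH) => x; rewrite exprS.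
Qed.

Lemma poly_polyfun_mmap N (G : 'rV[k]_d -> 'I_N -> {poly k}) p :
  (forall i, poly_polyfun (fun x => G x i)) -> poly_polyfun (fun x => mmap (@polyC k) (G x) p).
Proof.
move=> cG; apply: poly_polyfun_sum => i; apply: poly_polyfunM; first exact: poly_polyfun_cst.
by apply: poly_polyfun_prod => j; apply: poly_polyfunX.
Qed.

Variable n : nat.
Local Notation R := (trunc_ring k n).

Definition trunc_polyfun (G : 'rV[k]_d -> R) := poly_polyfun (fun x => G x : {poly k}).

Lemma trunc_polyfun_pi G : poly_polyfun G ->
  trunc_polyfun (fun x => in_qpoly ('X^(n.+1) : {poly k}) (G x)).
Proof.
move=> cG s; apply: (@polyfun_ext _ _ (fun x => if (s < n.+1)%N then (G x)`_s else 0)).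
  by move=> x; rewrite coef_pi.
by case: ltnP => _ //; apply: polyfun_cst.
Qed.

Lemma trunc_polyfun_ext G G' : G =1 G' -> trunc_polyfun G -> trunc_polyfun G'.
Proof. by move=> GG'; apply: poly_polyfun_ext => x; rewrite GG'. Qed.

Lemma trunc_polyfunM G G' : trunc_polyfun G -> trunc_polyfun G' ->
  trunc_polyfun (fun x => G x * G' x).
Proof.
move=> rG rG'; apply: trunc_polyfun_ext (trunc_polyfun_pi (poly_polyfunM rG rG')) => x.
by rewrite rmorphM; congr (_ * _); apply: pi_val.
Qed.

Lemma trunc_polyfun_sum I (r : seq I) (G : I -> 'rV[k]_d -> R) :
  (forall i, trunc_polyfun (G i)) -> trunc_polyfun (fun x => \sum_(i <- r) G i x).
Proof.
move=> rG; apply: trunc_polyfun_ext (trunc_polyfun_pi (poly_polyfun_sum r xpredT rG)) => x.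
by rewrite rmorph_sum; apply: eq_bigr => i _; apply: pi_val.
Qed.

Lemma polyfun_coords p (v : 'rV[k]_d -> 'rV[R]_p) :
  (forall i, trunc_polyfun (fun x => v x 0 i)) -> forall j, polyfun (fun x => coords (v x) 0 j).
Proof.
move=> rv j; case/mxvec_indexP: j => i s.
by apply: polyfun_ext (rv i s) => x; rewrite mxvecE mxE.
Qed.

Lemma polyfun_mulT p q (M : 'rV[k]_d -> 'M[R]_(p, q)) :
  (forall i j, trunc_polyfun (fun x => M x i j)) ->
  forall i j, polyfun (fun x => mulT (M x) i j).
Proof.
move=> rM i j.
apply: (@polyfun_ext _ _ (fun x => coords (uncoords (delta_mx 0 i) *m M x) 0 j)).
  by move=> x; rewrite mxE.
apply: polyfun_coords => l.
apply: (@trunc_polyfun_ext (fun x => \sum_a (uncoords (delta_mx 0 i) : 'rV[R]_p) 0 a * M x a l)).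
  by move=> x; rewrite mxE.
by apply: trunc_polyfun_sum => a; apply: trunc_polyfunM => //; apply: poly_polyfun_cst.
Qed.

End Polynomiality.

Section JetPolynomiality.
Variables (k : closedFieldType) (N : nat).

Lemma poly_polyfun_jet l i : poly_polyfun (fun x : jet k N l => jet_poly x i).
Proof.
move=> s; case: (ltnP s l.+1) => sl.
  apply: (polyfun_ext _ (@polyfun_coord _ _ (mxvec_index i (inord s : 'I_l.+1)))) => x.
  by rewrite coef_jet_poly sl mxE.
apply: (polyfun_ext _ (@polyfun_cst _ _ 0)) => x.
by rewrite coef_jet_poly ltnNge sl.
Qed.

Lemma polyfun_jet d l (phi : 'rV[k]_d -> jet k N l) :
  (forall i, poly_polyfun (fun x => jet_poly (phi x) i)) ->
  forall j, polyfun (fun x => phi x 0 j).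
Proof.
move=> c j; case/mxvec_indexP: j => i s; apply: polyfun_ext (c i s) => x.
by rewrite coef_jet_poly ltn_ord inord_val mxE.
Qed.

Lemma poly_polyfun_trunc d l b (phi : 'rV[k]_d -> jet k N l) :
  (forall i, poly_polyfun (fun x => jet_poly (phi x) i)) ->
  forall i, poly_polyfun (fun x => jet_poly (trunc b (phi x)) i).
Proof.
move=> c i s; apply: (@polyfun_ext _ _ (fun x => if (s < b.+1)%N then (jet_poly (phi x) i)`_s else 0)).
  by move=> x; rewrite jet_poly_trunc coef_take_poly.
by case: ltnP => _; [apply: c | apply: polyfun_cst].
Qed.

Lemma polyfun_trunc l b j : polyfun (fun x : jet k N l => trunc b x 0 j).
Proof. by apply: polyfun_jet => i; apply: poly_polyfun_trunc => i'; apply: poly_polyfun_jet. Qed.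

Lemma polyfun_top l j : polyfun (fun x : jet k N l.+1 => top x 0 j).
Proof. by apply: (polyfun_ext _ (@poly_polyfun_jet l.+1 j l.+1)) => x; rewrite mxE. Qed.

Lemma polyfun_ext_jet l j : polyfun (fun z : 'rV[k]_(N * l.+1 + N) => ext z 0 j).
Proof.
case/mxvec_indexP: j => i s.
apply: (@polyfun_ext _ _ (fun z => if (s <= l)%N then
   (jet_poly (lsubmx z : jet k N l) i)`_s else rsubmx z 0 i)).
  by move=> z; rewrite [RHS]mxvecE [RHS]mxE.
case: leqP => sl.
  apply: (polyfun_comp (h := fun x : jet k N l => (jet_poly x i)`_s)); first exact: poly_polyfun_jet.
  by move=> j; apply: (polyfun_ext _ (@polyfun_coord _ _ (lshift N j))) => x; rewrite mxE.
by apply: (polyfun_ext _ (@polyfun_coord _ _ (rshift _ i))) => x; rewrite mxE.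
Qed.

Variables (n m : nat) (f : 'I_m -> {mpoly k[N]}).

Lemma polyfun_eqs l j : polyfun (fun x : jet k N l => coords (eqs n f x) 0 j).
Proof.
apply: polyfun_coords => i.
apply: (@trunc_polyfun_ext _ _ n (fun x => in_qpoly ('X^(n.+1) : {poly k}) (jet_eval x (f i)))).
  by move=> x; rewrite mxE.
by apply: trunc_polyfun_pi; apply: poly_polyfun_mmap => i'; apply: poly_polyfun_jet.
Qed.

Lemma polyfun_mulT_jac l b a i j :
  polyfun (fun x : jet k N l => mulT (tR k n ^+ a *: jac n f (trunc b x)) i j).
Proof.
apply: polyfun_mulT => i' j'.
apply: (@trunc_polyfun_ext _ _ n (fun x : jet k N l => tR k n ^+ a *
  in_qpoly ('X^(n.+1) : {poly k}) (jet_eval (trunc b x) (mderiv i' (f j'))))).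
  by move=> x; rewrite !mxE.
apply: trunc_polyfunM; first exact: poly_polyfun_cst.
apply: trunc_polyfun_pi; apply: poly_polyfun_mmap => i''.
by apply: poly_polyfun_trunc => i'''; apply: poly_polyfun_jet.
Qed.

End JetPolynomiality.

(** * Triviality of one truncation step *)
Section Fibrations.
Variables (k : closedFieldType) (N m : nat) (f : 'I_m -> {mpoly k[N]}).
Variables (n : nat) (e : m.-tuple nat).
Hypotheses (mN : (m <= N)%N) (se : sorted leq e).
Hypothesis he : all (fun x => x < uphalf n)%N e.

Local Notation b := (expo e m).
Local Notation t := (tR k n).
Local Notation codim l := (\max_(a < m.+1 | (expo e a < n - l)%N) a).
Local Notation liftable := (liftable n f e b).

Let ae : all (fun x => x <= n.+1)%N e.
Proof. by apply: sub_all he => x; lia. Qed.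

Let be : all (fun x => x <= b)%N e := expo_max se.

Lemma rank_has_type (A : 'M_(N, m)) j : has_type A e ->
  \rank (mulT (t ^+ j *: A)) = expected_rank n m e j.
Proof.
move=> te; case: (leqP j n) => [/te //|nj].
rewrite expected_rank_top // tRX_eq0 // scale0r.
have -> : mulT 0 = 0 :> 'M[k]_(N * n.+1, m * n.+1).
  apply/row_matrixP => i; rewrite rowE -[delta_mx _ _]uncoordsK mul_coords mulmx0.
  by rewrite coords0 row0.
exact: mxrank0.
Qed.

Definition next_image_mx l (y : jet k N b) := mulT (t ^+ l.+2 *: jac n f y).
Definition first_order_mx l (y : jet k N b) := cst_mx k n N *m mulT (t ^+ l.+1 *: jac n f y).

Lemma rank_next_image l y : has_type (jac n f y) e ->
  \rank (next_image_mx l y) = expected_rank n m e l.+2.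
Proof. exact: rank_has_type. Qed.

Lemma rank_next_and_first_order l y : has_type (jac n f y) e -> (l < n)%N ->
  \rank (col_mx (next_image_mx l y) (first_order_mx l y)) =
  (expected_rank n m e l.+2 + codim l)%N.
Proof.
move=> te ln; have [er _] := image_constant_split (jac n f y) l.+1.
by rewrite -expected_rank_step // -(rank_has_type _ te) er.
Qed.

Lemma polyfun_next_image l i j : polyfun (fun y => next_image_mx l y i j).
Proof.
by apply: (polyfun_ext _ (polyfun_mulT_jac f b b l.+2 i j)) => y; rewrite trunc_id.
Qed.

Lemma polyfun_first_order l i j : polyfun (fun y => first_order_mx l y i j).
Proof.
apply: polyfun_mulmx => i' j'; first exact: polyfun_cst.
by apply: (polyfun_ext _ (polyfun_mulT_jac f b b l.+1 i' j')) => y; rewrite trunc_id.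
Qed.

Lemma polyfun_frame l r a (S : 'M[k]_(r, N * n.+1)) (E : 'M[k]_(a, N)) C i j :
  polyfun (fun y => frame (next_image_mx l y) (first_order_mx l y) S E C i j).
Proof.
apply: polyfun_mulmx => [i' j'|? ?]; last exact: polyfun_cst.
case: (split_ordP i') => l' ->.
  apply: (@polyfun_ext _ _ (fun y => (S *m next_image_mx l y) l' j')).
    by move=> y; rewrite col_mxEu.
  by apply: polyfun_mulmx => ? ?; [apply: polyfun_cst | apply: polyfun_next_image].
apply: (@polyfun_ext _ _ (fun y => (E *m first_order_mx l y) l' j')).
  by move=> y; rewrite col_mxEd.
by apply: polyfun_mulmx => ? ?; [apply: polyfun_cst | apply: polyfun_first_order].
Qed.

(** On O the same constant matrices exhibit the equations of the step from l to
   l + 1 as a system of maximal rank. *)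
Definition framed (O : jet k N b -> Prop) l :=
  exists (S : 'M_(expected_rank n m e l.+2, N * n.+1)) (E : 'M_(codim l, N)) C,
    forall y, O y -> frame (next_image_mx l y) (first_order_mx l y) S E C \in unitmx.

(** The data for all l are functions of the truncation at level b, so the
   finitely many determinants define one neighbourhood there. *)
Lemma framed_neighbourhood y : has_type (jac n f y) e ->
  exists O, [/\ zopen O, O y & forall l, (l < n)%N -> framed O l].
Proof.
move=> te.
suff : forall j, (j <= n)%N -> exists O, [/\ zopen O, O y & forall l, (l < j)%N -> framed O l].
  by apply.
elim=> [_|j IH jn]; first by exists (fun=> True); split=> //; apply: zopen_true.
have [O [oO Oy fO]] := IH (ltnW jn).
have [S [E [C eC]]] :=
  rank_complement_rows (rank_next_image j te) (rank_next_and_first_order te jn).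
exists (fun z => O z /\ \det (frame (next_image_mx j z) (first_order_mx j z) S E C) != 0); split.
- by apply: zopen_and => //; apply: zopen_neq0; apply: polyfun_det; apply: polyfun_frame.
- by split=> //; rewrite /frame eC det1 oner_eq0.
- move=> l; rewrite ltnS leq_eqVlt => /predU1P[->|lj].
    by exists S, E, C => z [_ dz]; rewrite unitmxE unitfE.
  by have [S' [E' [C' h]]] := fO l lj; exists S', E', C' => z [Oz _]; apply: h.
Qed.

Definition piece (U : jet k N b -> Prop) i (x : jet k N i) :=
  stratum_image n f e i x /\ U (trunc b x).

(** By [liftable_step] the next coefficients are the solutions of a membership
   condition in a row space, which [residueP] converts into the vanishing of the
   residue, an affine function of these coefficients. *)
Lemma piece_fibration (O U : jet k N b -> Prop) l :
  (forall y, U y <-> stratum_image n f e b y /\ O y) -> framed O l ->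
  (exists y, U y) -> (b <= l < n)%N ->
  trivial_fibration (piece U (i:=l.+1)) (piece U (i:=l)) (trunc l)
    (@affine_space k (N - codim l)).
Proof.
move=> UO [S [E [C uG]]] [y0 Uy0] /andP[bl ln].
have bn : (b <= n)%N by lia.
have SP i (x : jet k N i) : (b <= i <= n)%N -> stratum_image n f e i x <-> liftable x.
  by move=> bi; apply: stratum_imageP.
pose T (y : jet k N l) := next_image_mx l (trunc b y).
pose A (y : jet k N l) := first_order_mx l (trunc b y).
pose res p (y : jet k N l) (w : 'M[k]_(p, m * n.+1)) := residue (T y) (A y) S E C w.
have uP (y : jet k N l) : piece U y -> frame (T y) (A y) S E C \in unitmx.
  by move=> [_ /UO[_ Oy]]; apply: uG.
have mtr : morphism (piece U (i:=l)) (fun=> True) (fun y : jet k N l => trunc b y).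
  by apply: morphism_polyfun => // j; apply: polyfun_trunc.
have rres p (w : jet k N l -> 'M[k]_(p, m * n.+1)) :
    regular_mx (piece U (i:=l)) w -> regular_mx (piece U (i:=l)) (fun y => res p y (w y)).
  move=> rw; rewrite /res /residue; apply: regular_mx_mul; last exact: regular_mx_cst.
  apply: regular_mx_mul; first by apply: regular_mx_mul => //; apply: regular_mx_cst.
  apply: regular_invmx => // i j.
  apply: (regular_comp (h := fun y => frame (next_image_mx l y) (first_order_mx l y) S E C i j)) mtr.
  by apply: regular_polyfun; apply: polyfun_frame.
have fE : row_free E.
  apply/row_freeP; exists (residue (next_image_mx l y0) (first_order_mx l y0) S E C (first_order_mx l y0)).
  by apply: residue_E; apply: uG; case/UO: Uy0.
apply: (@affine_bundle k _ _ N (codim l) _ _ _ (@top k N l) (@ext k N l)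
  (fun y => res _ y (coords (eqs n f y))) (fun y => res _ y (A y)) E) => //.
- exact: polyfun_trunc.
- exact: polyfun_top.
- exact: polyfun_ext_jet.
- exact: trunc_top_ext.
- exact: ext_trunc_top.
- by apply: rres => i j; rewrite ord1; apply: regular_polyfun; apply: polyfun_eqs.
- apply: rres => i j.
  apply: (regular_comp (h := fun y => first_order_mx l y i j)) mtr.
  by apply: regular_polyfun; apply: polyfun_first_order.
- by move=> y Uy; apply: residue_E; apply: uP.
move=> x; rewrite /piece (trunc_trunc x bl).
have key : liftable (trunc l x) -> O (trunc b x) ->
   ((coords (eqs n f (trunc l x)) + top x *m step_mx n f b (trunc l x))%R
     <= mulT (t ^+ l.+2 *: jac n f (trunc b x)))%MS <->
   res _ (trunc l x) (coords (eqs n f (trunc l x))) +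
     top x *m res _ (trunc l x) (A (trunc l x)) = 0.
  move=> lx Ox; have [te eqx] := lx; rewrite (trunc_trunc x bl) in te.
  have -> : res _ (trunc l x) (coords (eqs n f (trunc l x))) +
     top x *m res _ (trunc l x) (A (trunc l x)) =
     res _ (trunc l x) (coords (eqs n f (trunc l x)) + top x *m step_mx n f b (trunc l x)).
    by rewrite /res /residue !mulmxDl !mulmxA.
  have uGx : frame (T (trunc l x)) (A (trunc l x)) S E C \in unitmx.
    by apply: uG; rewrite (trunc_trunc x bl).
  have := @residueP _ _ _ _ _ _ _ _ _ _ _ uGx _
    (coords (eqs n f (trunc l x)) + top x *m step_mx n f b (trunc l x)).
  rewrite /res /T /A (trunc_trunc x bl) => ->.
  - by split=> /eqP.
  - exact: rank_next_image.
  - exact: rank_next_and_first_order.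
  - apply: addmx_sub; first by move: eqx; rewrite sub_step_mx /step_mx (trunc_trunc x bl).
    rewrite -addsmxE /step_mx (trunc_trunc x bl).
    exact: submx_trans (submxMl _ _) (addsmxSr _ _).
have b1 : (b <= l.+1 <= n)%N by lia.
have b0 : (b <= l <= n)%N by lia.
split=> [[/(SP _ _ b1) lx Ux]|[[/(SP _ _ b0) lx Ux] eqx]].
  have [lx' eqx] := (liftable_step f mN se ae be x bl).1 lx.
  have Ox : O (trunc b x) by case/UO: Ux.
  split; first by split; [apply/(SP _ _ b0) | exact: Ux].
  exact: (key lx' Ox).1.
have Ox : O (trunc b x) by case/UO: Ux.
split; last exact: Ux.
apply/(SP _ _ b1); apply: (liftable_step f mN se ae be x bl).2.
by split; [exact: lx | exact: (key lx Ox).2].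
Qed.

End Fibrations.

(** * Local closedness and composed fibrations *)
Section Main.
Variables (k : closedFieldType) (N m : nat) (f : 'I_m -> {mpoly k[N]}).
Variables (n : nat) (e : m.-tuple nat).
Hypotheses (mN : (m <= N)%N) (se : sorted leq e).
Hypothesis he : all (fun x => x < uphalf n)%N e.

Local Notation b := (expo e m).
Local Notation t := (tR k n).
Local Notation codim l := (\max_(a < m.+1 | (expo e a < n - l)%N) a).

Let ae : all (fun x => x <= n.+1)%N e.
Proof. by apply: sub_all he => x; lia. Qed.

Let be : all (fun x => x <= b)%N e := expo_max se.

(** Lower bounds on ranks are open and upper bounds are closed.  Once the rank of
   t^(l+1) times the Jacobian matrix is prescribed, the equations lie in its row
   space when appending them as a row does not raise that rank. *)
Lemma image_locally_closed l : (b <= l <= n)%N -> zlocally_closed (stratum_image n f e l).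
Proof.
move=> bl; pose T j (x : jet k N l) := mulT (t ^+ j *: jac n f (trunc b x)).
have pT j i i' : polyfun (fun x => T j x i i') by apply: polyfun_mulT_jac.
exists (fun x => forall j, (j < n.+1)%N -> (expected_rank n m e j <= \rank (T j x))%N).
exists (fun x => (forall j, (j < n.+1)%N -> (\rank (T j x) <= expected_rank n m e j)%N) /\
  (\rank (col_mx (T l.+1 x) (coords (eqs n f x))) <= expected_rank n m e l.+1)%N).
split.
- by apply: zopen_ltn => j; apply: zopen_rank_ge; apply: pT.
- apply: zclosed_and.
    apply: zclosed_forall => j; apply: zclosed_forall => _.
    by apply: zclosed_rank_le; apply: pT.
  apply: zclosed_rank_le => i j; case: (split_ordP i) => i' ->.
    by apply: (polyfun_ext _ (pT l.+1 i' j)) => x; rewrite col_mxEu.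
  apply: (polyfun_ext _ (polyfun_eqs (n := n) f l j)) => x.
  by rewrite col_mxEd ord1.
move=> x; rewrite (stratum_imageP f mN se ae be he x bl).
have incl (te : has_type (jac n f (trunc b x)) e) :
    (coords (eqs n f x) <= T l.+1 x)%MS <->
    (\rank (col_mx (T l.+1 x) (coords (eqs n f x))) <= expected_rank n m e l.+1)%N.
  rewrite -(rank_has_type l.+1 te) -/(T l.+1 x).
  have sT : (T l.+1 x <= col_mx (T l.+1 x) (coords (eqs n f x)))%MS.
    by rewrite -addsmxE addsmxSl.
  rewrite (geq_leqif (mxrank_leqif_sup sT)) -addsmxE addsmx_sub submx_refl.
  by split.
split=> [[te eqx]|[hO [hC /incl eqx]]].
  split=> [j|]; first by rewrite ltnS => jn; rewrite /T te.
  split=> [j|]; first by rewrite ltnS => jn; rewrite /T te.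
  exact: (incl te).1.
have te : has_type (jac n f (trunc b x)) e.
  by move=> j; rewrite -ltnS => jn; apply/eqP; rewrite eqn_leq hO ?hC.
by split; [exact: te | exact: eqx].
Qed.

Lemma piece_trunc (U : jet k N b -> Prop) l j (x : jet k N j) :
  (b <= l <= j)%N -> piece f n U x -> piece f n U (trunc l x).
Proof.
move=> /andP[bl lj] [[th sth <-] Ux]; split.
  by exists th; rewrite ?(trunc_trunc th lj).
by rewrite (trunc_trunc _ bl).
Qed.

Lemma piece_fibration_comp (O U : jet k N b -> Prop) l j :
  (forall y, U y <-> stratum_image n f e b y /\ O y) ->
  (forall i, (i < n)%N -> framed f n O i) ->
  (exists y, U y) -> (b <= l)%N -> (l <= j <= n)%N ->
  trivial_fibration (piece f n (e := e) U (i:=j)) (piece f n U (i:=l)) (trunc l)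
    (@affine_space k (\sum_(l <= i < j) (N - codim i))).
Proof.
move=> UO fO exU bl /andP[lj]; elim: j lj => [|j IH].
  rewrite leqn0 => /eqP l0 _; subst l; rewrite big_geq //.
  apply: (trivial_fibration_ext _ _ _
    (trivial_fibration_id (piece f n (e := e) U (i := 0%N)))) => // x _.
  by rewrite trunc_id.
rewrite leq_eqVlt => /predU1P[<- _|lj jn].
  rewrite big_geq //.
  apply: (trivial_fibration_ext _ _ _
    (trivial_fibration_id (piece f n (e := e) U (i := l)))) => // x _.
  by rewrite trunc_id.
have step := piece_fibration mN se he UO (fO j jn) exU (l := j).
have bjn : (b <= j < n)%N by rewrite jn (leq_trans bl).
rewrite big_nat_recr //=.
apply: (trivial_fibration_ext _ _ _
  (trivial_fibration_comp (step bjn) (IH lj (ltnW jn)))) => // x _.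
by rewrite trunc_trunc.
Qed.

End Main.

Theorem proposition2 (k : closedFieldType) (N m : nat)
    (f : 'I_m -> {mpoly k[N]}) (n : nat) (e : m.-tuple nat)
    (hmN : (m <= N)%N)
    (he_sorted : sorted leq e)
    (he_lt : all (fun x => x < uphalf n)%N e) :
  [/\
    (* (a) *)
    forall l : nat, (expo e m <= l <= n)%N ->
      zlocally_closed (stratum_image n f e l),
    (* (b) *)
    forall gamma : jet k N (expo e m), stratum_image n f e (expo e m) gamma ->
      exists U : jet k N (expo e m) -> Prop,
        [/\ open_in (stratum_image n f e (expo e m)) U, U gamma &
          let Ui := fun (i : nat) (x : jet k N i) =>
            stratum_image n f e i x /\ U (trunc (expo e m) x) in
          forall l : nat, (expo e m <= l < n)%N ->
            trivial_fibration (Ui l.+1) (Ui l) (trunc l)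
              (@affine_space k
                (N - \max_(a < m.+1 | (expo e a < n - l)%N) a)%N)] &
    (* (c) *)
    forall l : nat, (expo e m <= l < n)%N ->
      exists r : nat,
        [/\ locally_trivial_fibration (stratum n f e) (stratum_image n f e l)
              (trunc l) (@affine_space k r),
            (l <= n - expo e m)%N ->
              r = ((N - m) * (n - l) + \sum_(x <- e) x)%N &
            l = expo e m -> (m < N)%N -> (uphalf ((N - m).+1 * n) <= r)%N]].
Proof.
have ae : all (fun x => x <= n.+1)%N e by apply: sub_all he_lt => x; lia.
have be := expo_max he_sorted.
set b := expo e m in be *.
have bn : (b < uphalf n \/ b = 0)%N.
  rewrite /b /expo; case: m e he_lt {he_sorted ae be b hmN f} => [|m'] e' /=; first by right.
  by move/all_nthP => h; left; apply: h; rewrite size_tuple.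
have nbhd (gamma : jet k N b) : (b <= n)%N -> stratum_image n f e b gamma ->
    exists O, [/\ zopen O, O gamma & forall l, (l < n)%N -> framed f n O l].
  move=> bn'; rewrite (stratum_imageP f hmN he_sorted ae be he_lt) ?leqnn // => -[te _].
  by rewrite trunc_id in te; apply: framed_neighbourhood.
split.
- exact: image_locally_closed.
- move=> gamma sg; have bn' : (b <= n)%N by lia.
  have [O [oO Og fO]] := nbhd gamma bn' sg.
  pose U (z : jet k N b) := stratum_image n f e b z /\ O z.
  have UO z : U z <-> stratum_image n f e b z /\ O z by [].
  have exU : exists z, U z by exists gamma.
  exists U; split=> //; first by exists O.
  move=> Ui l bl; have ln : (l < n)%N by case/andP: bl.
  exact: (piece_fibration hmN he_sorted he_lt UO (fO l ln) exU bl).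
move=> l /andP[bl ln].
pose r := (\sum_(l <= i < n) (N - \max_(a < m.+1 | (expo e a < n - i)%N) a))%N.
have rE : (r + expected_rank n m e l.+1 = N * (n - l))%N.
  by rewrite sum_fibre_dimensions ?leqnn ?(ltnW ln) // expected_rank_top // addn0.
have rlow : (l <= n - b)%N -> r = ((N - m) * (n - l) + \sum_(x <- e) x)%N.
  move=> lb; have : (expected_rank n m e l.+1 + \sum_(x <- e) x = m * (n - l))%N.
    rewrite expected_rankE -big_split /= -[m in RHS](size_tuple e) -sum1_size big_distrl /=.
    rewrite big_seq [RHS]big_seq; apply: eq_bigr => x xe.
    by have := allP be x xe; lia.
  have : (N * (n - l) = (N - m) * (n - l) + m * (n - l))%N by rewrite -mulnDl subnK.
  lia.
exists r; split=> //.
- split.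
    apply: morphism_polyfun => [x sx|j]; last exact: polyfun_trunc.
    by exists x.
  move=> y [th sth thy].
  have bn' : (b <= n)%N by lia.
  have sg : stratum_image n f e b (trunc b y).
    by exists th => //; rewrite -thy trunc_trunc.
  have [O [oO Og fO]] := nbhd _ bn' sg.
  pose U (z : jet k N b) := stratum_image n f e b z /\ O z.
  exists (piece f n (e := e) U (i := l)); split.
  + exists (fun x => O (trunc b x)).
      by apply: zopen_preim => // j; apply: polyfun_trunc.
    move=> x; split=> [[sx [_ Ox]] //|[sx Ox]]; split=> //; split=> //.
    by case: sx => th' sth' <-; exists th' => //; rewrite trunc_trunc.
  + by split; [exists th | split].
  have exU : exists z, U z by exists (trunc b y).
  have lnn : (l <= n <= n)%N by rewrite leqnn ltnW.
  have UO z : U z <-> stratum_image n f e b z /\ O z by [].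
  apply: (trivial_fibration_ext _ _ _
    (piece_fibration_comp hmN he_sorted he_lt UO fO exU bl lnn)) => //.
  + move=> x; split=> [px|[sx [_ Ux]]].
      split; last by apply: piece_trunc px; rewrite bl ltnW.
      by case: px => -[th' sth' <-] _; rewrite trunc_id.
    split; first by exists x; rewrite ?trunc_id.
    by rewrite (trunc_trunc x bl) in Ux.
move=> lb mN'; have lnb : (l <= n - b)%N by lia.
(* With N - m = q + 1 and s >= l, the bound 2 l <= n gives
   2 ((q + 1) (n - l) + s) >= q n + 2 n. *)
rewrite (rlow lnb); have := expo_le_sum e; rewrite -/b -lb.
have : (l.*2 <= n)%N by lia.
have -> : (N - m).+1 = ((N - m).-1).+2 by rewrite prednK // subn_gt0.
have -> : (N - m = ((N - m).-1).+1)%N by rewrite prednK // subn_gt0.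
move: (\sum_(x <- e) x)%N (N - m).-1 => s q h1 h2.
have : (q * n <= q * (n - l).*2)%N by rewrite leq_mul2l; lia.
by rewrite !mulSn -muln2 mulnA muln2; lia.
Qed.
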